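(* Let $f:\mathbb{R}^d\to\mathbb{R}$ be the (differentiable) objective function. Assume that the stochastic gradient $\nabla f_\xi(x)$ at a point $x\in\mathbb{R}^d$ has an absolutely continuous distribution and a finite second moment \[ \mathbb{E}\,(\nabla f_\xi(x)-\nabla f(x))(\nabla f_\xi(x)-\nabla f(x))^\top=\Sigma . \] Let $\theta>0$. Then, for any positive integers $m$ and $n$, it holds that \[ \mathbb{E}\left\|\mathrm{SMoM}_{m,n}(\nabla f_\xi(x),\theta)-\nabla f(x)\right\|^2\le 4(2m+1)\left(\frac{\mathrm{Tr}(\Sigma)}{n}+\theta^2 d\right). \] If, in addition, $m\ge 3$ and $n\theta^2\gtrsim m\|\Sigma\|$, then \[ \left\|\mathbb{E}\,\mathrm{SMoM}_{m,n}(\nabla f_\xi(x),\theta)-\nabla f(x)\right\|\lesssim \frac{m}{\theta n}\sqrt{\mathrm{Tr}(\Sigma^2)} . \]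
   Context: The stochastic gradient $\nabla f_\xi(x)$ is the random vector in $\mathbb{R}^d$ returned by a stochastic first-order oracle at $x$ as an estimate of the true gradient $\nabla f(x)$. $\|\cdot\|$ is the Euclidean norm for vectors and the spectral norm for matrices. The relations $g\lesssim h$ and $h\gtrsim g$ both mean $g=\mathcal{O}(h)$. Smoothed median of means: for a random element $\zeta$ in $\mathbb{R}^d$, $\theta>0$ and positive integers $m,n$, let $\zeta_1,\dots,\zeta_{(2m+1)n}$ be i.i.d. copies of $\zeta$ and let $\eta_1,\dots,\eta_{2m+1}\sim\mathcal{N}(0,I_d)$ be independent standard Gaussian vectors (also independent of the $\zeta_i$). For $j\in\{0,\dots,2m\}$ put $\upsilon_{j}=\frac1n\sum_{i=1}^{n}\zeta_{jn+i}+\theta\,\eta_{j+1}$. Then $\mathrm{SMoM}_{m,n}(\zeta,\theta)=\mathrm{Med}(\upsilon_0,\dots,\upsilon_{2m})$, where $\mathrm{Med}$ of $2m+1$ vectors is the $(m+1)$-th order statistic taken component-wise.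
   Formalization: The formal theorem additionally assumes that the stochastic gradient is unbiased, i.e. its expectation at x equals the true gradient ∇f(x); without this both bounds fail, e.g. for a Gaussian stochastic gradient with a fixed nonzero bias as n grows (and θ tends to 0 in the first bound). *)

(* Defs.v *)
From HB Require Import structures.
From mathcomp Require Export all_boot all_order all_algebra.
From mathcomp Require Export all_classical all_reals all_analysis.

Set Implicit Arguments.
Unset Strict Implicit.
Unset Printing Implicit Defensive.

Import Order.TTheory GRing.Theory Num.Theory.
Import numFieldNormedType.Exports.

Local Open Scope classical_set_scope.
Local Open Scope ring_scope.

(* Borel sigma-algebra; 'rV[R]_d carries the sup-norm topology, which is the
   Euclidean one. *)
HB.instance Definition _ (R : realType) (d : nat) :=
  @isMeasurable.Build (sigma_display (@open 'rV[R]_d)) 'rV[R]_d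
    <<s @open 'rV[R]_d >> (@sigma_algebra0 _ setT _) (@sigma_algebraC _ _)
    (@sigma_algebra_bigcup _ setT _).

Section euclidean_space.
Context {R : realType} {d : nat}.

(* The library norm `|v| on 'rV[R]_d is the sup norm. *)
Definition enorm (v : 'rV[R]_d) : R := Num.sqrt (\sum_(k < d) v 0 k ^+ 2).

(* Points of R^d are row vectors, so v *m A^T stands for the product A v. *)
Definition spectral_norm (A : 'M[R]_d) : R :=
  sup [set enorm (v *m A^T) | v in [set v | enorm v <= 1]].

Definition grad (f : 'rV[R]_d -> R) (x : 'rV[R]_d) : 'rV[R]_d :=
  \row_k 'D_(delta_mx 0 k) f x.

Definition box (a b : 'rV[R]_d) : set 'rV[R]_d :=
  [set v | forall k, a 0 k <= v 0 k <= b 0 k].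

Definition box_volume (a b : 'rV[R]_d) : R := \prod_(k < d) (b 0 k - a 0 k).

(* Lebesgue outer measure on R^d: on Borel sets it is the Lebesgue measure. *)
Definition lebesgue_rV (A : set 'rV[R]_d) : \bar R :=
  ereal_inf [set (\sum_(0 <= i <oo) (box_volume (c i).1 (c i).2)%:E)%E
            | c in [set c : nat -> 'rV[R]_d * 'rV[R]_d |
                (forall i k, (c i).1 0 k <= (c i).2 0 k) /\
                A `<=` \bigcup_i box (c i).1 (c i).2]].

End euclidean_space.

Definition mutually_independent {R : realType} {dT dV} {T : measurableType dT}
    {V : measurableType dV} (P : probability T R) (I : finType)
    (X : I -> T -> V) : Prop :=
  forall B : I -> set V, (forall i, measurable (B i)) ->
    P (\bigcap_i (X i @^-1` B i)) = (\prod_(i : I) P (X i @^-1` B i))%E.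

Section random_vectors.
Context {R : realType} {d : nat}.

Definition same_distribution {dT dU} {T : measurableType dT}
    {U : measurableType dU} (P : probability T R) (Q : probability U R)
    (X : {RV P >-> 'rV[R]_d}) (Y : {RV Q >-> 'rV[R]_d}) : Prop :=
  forall B, measurable B -> distribution P X B = distribution Q Y B.

Definition std_gaussian {dT} {T : measurableType dT} (P : probability T R)
    (X : {RV P >-> 'rV[R]_d}) : Prop :=
  mutually_independent P (fun (k : 'I_d) w => X w 0 k) /\
  (forall k (B : set R), measurable B ->
     P [set w | B (X w 0 k)] = normal_prob 0 1 B).

Definition mean_vec {dT} {T : measurableType dT} (P : probability T R)
    (X : T -> 'rV[R]_d) : 'rV[R]_d :=
  \row_k fine ('E_P[(fun w => X w 0 k)%R])%E.

(* Oracle at x: the random vector g is an unbiased estimate of grad f x, its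
   distribution is absolutely continuous and its second moment about grad f x
   is Sigma. Equalities between expectations and finite values in \bar R, with
   the (i, i) integrands nonnegative, make all these moments finite. *)
Definition stochastic_gradient_at {dU} {U : measurableType dU}
    (Q : probability U R) (f : 'rV[R]_d -> R) (x : 'rV[R]_d)
    (g : {RV Q >-> 'rV[R]_d}) (Sigma : 'M[R]_d) : Prop :=
  [/\ distribution Q g `<< lebesgue_rV,
      forall k, ('E_Q[(fun u => g u 0 k)%R] = (grad f x 0%R k)%:E)%E &
      forall i j,
        ('E_Q[(fun u => ((g u - grad f x)^T *m (g u - grad f x)) i j)%R]
         = (Sigma i j)%:E)%E].

End random_vectors.

Lemma block_index_subproof (p n : nat) (j : 'I_p) (i : 'I_n) :
  (j * n + i < p * n)%N.
Proof.
apply: (@leq_trans (j.+1 * n)); first by rewrite mulSn addnC ltn_add2r.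
by rewrite leq_mul2r ltn_ord orbT.
Qed.

Definition block_index (p n : nat) (j : 'I_p) (i : 'I_n) : 'I_(p * n) :=
  Ordinal (block_index_subproof j i).

Section smoothed_median_of_means.
Context {R : realType} {d : nat}.

(* Indices start at 0, so the (m+1)-th order statistic is item m of the
   increasing rearrangement. *)
Definition med (m : nat) (v : 'I_(2 * m).+1 -> 'rV[R]_d) : 'rV[R]_d :=
  \row_k nth 0 (sort <=%R [seq v j 0 k | j <- enum 'I_(2 * m).+1]) m.

Definition smom (m n : nat) (theta : R)
    (zeta : 'I_((2 * m).+1 * n) -> 'rV[R]_d)
    (eta : 'I_(2 * m).+1 -> 'rV[R]_d) : 'rV[R]_d :=
  med (fun j => n%:R^-1 *: (\sum_(i < n) zeta (block_index j i))
                + theta *: eta j).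

Definition smom_sample {dT dU} {T : measurableType dT} {U : measurableType dU}
    (P : probability T R) (Q : probability U R) (m n : nat)
    (g : {RV Q >-> 'rV[R]_d})
    (zeta : 'I_((2 * m).+1 * n) -> {RV P >-> 'rV[R]_d})
    (eta : 'I_(2 * m).+1 -> {RV P >-> 'rV[R]_d}) : Prop :=
  [/\ forall i, same_distribution (zeta i) g,
      forall j, std_gaussian (eta j) &
      mutually_independent P
        (fun k : 'I_((2 * m).+1 * n) + 'I_(2 * m).+1 =>
           match k with inl i => zeta i : T -> 'rV[R]_d | inr j => eta j end)].

Definition smom_rv {dT} {T : measurableType dT} (P : probability T R)
    (m n : nat) (theta : R)
    (zeta : 'I_((2 * m).+1 * n) -> {RV P >-> 'rV[R]_d})
    (eta : 'I_(2 * m).+1 -> {RV P >-> 'rV[R]_d}) : T -> 'rV[R]_d :=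
  fun w => smom theta (fun i => zeta i w) (fun j => eta j w).

End smoothed_median_of_means.

(* Main.v *)
Require Import Defs.
From HB Require Import structures.
From mathcomp Require Import all_boot all_order all_algebra.
From mathcomp Require Import all_classical all_reals all_analysis.
From mathcomp Require Import measurable_realfun zify ring lra.

(** Everything is done one coordinate at a time. Write the centered coordinate
of the [j]-th block as [v_j = sum_q xi_q + theta eta_j], where the [xi_q] are
independent, centered, of variance [Sigma_kk / n^2], and the [eta_j] are standard
Gaussian; there are [n] summands in each of the [2m+1] blocks.

Second moment: the median is one of the [v_j], so its square is at most
[sum_j v_j^2].

Bias (Lindeberg's replacement method): the median is odd, so without the [xi_q]
it has mean zero by symmetry of the Gaussian law. The [xi_q] are put back one at
a time. Given everything except [xi_q] and the noise [eta_j] of its block, the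
median is a 1-Lipschitz function of [xi_q + theta eta_j]; averaging over [eta_j]
turns it into a function of [xi_q] whose derivative is Lipschitz with constant
[O(1 / theta)]. The first-order term vanishes because [xi_q] is centered, so each
replacement costs [O(E xi_q^2 / theta)] and the total cost is
[O((2m+1) Sigma_kk / (theta n))]. Finally [sum_k Sigma_kk^2 <= Tr(Sigma^2)]. *)

Set Implicit Arguments.
Unset Strict Implicit.
Unset Printing Implicit Defensive.

Import Order.TTheory GRing.Theory Num.Theory.
Import numFieldNormedType.Exports.

Local Open Scope classical_set_scope.
Local Open Scope ring_scope.

(** * Integrable functions *)

Lemma le_integrable_EFin d (T : measurableType d) (R : realType)
    (mu : {measure set T -> \bar R}) (f g : T -> R) :
  measurable_fun setT f -> (forall x, `|f x| <= g x) ->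
  mu.-integrable setT (EFin \o g) -> mu.-integrable setT (EFin \o f).
Proof.
move=> mf fg; apply: le_integrable => //; first exact/measurable_EFinP.
by move=> x _; rewrite /= lee_fin (le_trans (fg x))// ler_norm.
Qed.

Lemma norm_Rintegral_le d (T : measurableType d) (R : realType)
    (mu : {measure set T -> \bar R}) (f g : T -> R) :
  measurable_fun setT f -> (forall x, `|f x| <= g x) ->
  mu.-integrable setT (EFin \o g) ->
  `|\int[mu]_x f x| <= \int[mu]_x g x.
Proof.
move=> mf fg ig; have i_f := le_integrable_EFin mf fg ig.
rewrite (le_trans (le_normr_Rintegral _ _))// le_Rintegral//.
exact: integrable_norm.
Qed.

Section integrable_EFin.
Context d (T : measurableType d) (R : realType).
Variable mu : {measure set T -> \bar R}.
Implicit Types f g : T -> R.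

Lemma integrable_EFinD f g : mu.-integrable setT (EFin \o f) ->
  mu.-integrable setT (EFin \o g) ->
  mu.-integrable setT (EFin \o (fun x => f x + g x)).
Proof. exact: integrableD. Qed.

Lemma integrable_EFinB f g : mu.-integrable setT (EFin \o f) ->
  mu.-integrable setT (EFin \o g) ->
  mu.-integrable setT (EFin \o (fun x => f x - g x)).
Proof. exact: integrableB. Qed.

Lemma integrable_EFinZ k f : mu.-integrable setT (EFin \o f) ->
  mu.-integrable setT (EFin \o (fun x => k * f x)).
Proof. exact: integrableZl. Qed.

End integrable_EFin.

Lemma integrable_EFin_sum d (T : measurableType d) (R : realType)
    (mu : {measure set T -> \bar R}) (I : Type) (s : seq I) (Q : pred I)
    (f : I -> T -> R) :
  (forall i, mu.-integrable setT (EFin \o f i)) ->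
  mu.-integrable setT (EFin \o (fun x => \sum_(i <- s | Q i) f i x)).
Proof.
move=> i_f; have -> : EFin \o (fun x => \sum_(i <- s | Q i) f i x) =
    (fun x => \sum_(i <- s | Q i) (EFin \o f i) x)%E.
  by apply/funext => x; rewrite /= sumEFin.
exact: integrable_sum.
Qed.

Lemma Rintegral_sum d (T : measurableType d) (R : realType)
    (mu : {measure set T -> \bar R}) (I : Type) (s : seq I) (Q : pred I) (f : I -> T -> R) :
  (forall i, mu.-integrable setT (EFin \o f i)) ->
  \int[mu]_x (\sum_(i <- s | Q i) f i x) = \sum_(i <- s | Q i) \int[mu]_x f i x.
Proof.
move=> i_f; elim: s => [|i s ih].
  under eq_Rintegral do rewrite big_nil.
  by rewrite big_nil Rintegral_cst// mul0r.
under eq_Rintegral do rewrite big_cons.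
rewrite big_cons; case: ifP => // _.
by rewrite RintegralD// ?ih//; exact: integrable_EFin_sum.
Qed.

Lemma integrable_of_sqr {R : realType} {d} {T : measurableType d}
    (P : probability T R) (f : T -> R) : measurable_fun setT f ->
  P.-integrable setT (EFin \o (fun w => f w ^+ 2)) -> P.-integrable setT (EFin \o f).
Proof.
move=> mf if2.
have h : P.-integrable setT (EFin \o (fun w => cst 1 w + f w ^+ 2)).
  by apply: integrable_EFinD => //; exact: finite_measure_integrable_cst.
apply: le_integrable_EFin h => // w /=.
rewrite ler_norml; apply/andP; split; nra.
Qed.

Section square_integrable.
Context {R : realType} {d} {T : measurableType d} (P : probability T R).

Lemma integrable_mul_of_sqr (f g : T -> R) :
  measurable_fun setT f -> measurable_fun setT g ->
  P.-integrable setT (EFin \o (fun w => f w ^+ 2)) ->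
  P.-integrable setT (EFin \o (fun w => g w ^+ 2)) ->
  P.-integrable setT (EFin \o (fun w => f w * g w)).
Proof.
move=> mf mg if2 ig2; apply: le_integrable_EFin (integrable_EFinD if2 ig2).
  exact: measurable_funM.
by move=> w; rewrite ler_norml; apply/andP; split; nra.
Qed.

Lemma integrable_sqrD (f g : T -> R) :
  measurable_fun setT f -> measurable_fun setT g ->
  P.-integrable setT (EFin \o (fun w => f w ^+ 2)) ->
  P.-integrable setT (EFin \o (fun w => g w ^+ 2)) ->
  P.-integrable setT (EFin \o (fun w => (f w + g w) ^+ 2)).
Proof.
move=> mf mg if2 ig2.
apply: le_integrable_EFin (integrable_EFinZ 2 (integrable_EFinD if2 ig2)).
  by apply: measurable_funX; exact: measurable_funD.
by move=> w; rewrite ger0_norm ?sqr_ge0//; have := sqr_ge0 (f w - g w); lra.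
Qed.

End square_integrable.

Section integral_law.
Context {R : realType} {d dA} {T : measurableType d} {A : measurableType dA}.
Variables (P : {measure set T -> \bar R}) (nu : {measure set A -> \bar R}).
Variable X : T -> A.
Hypotheses (mX : measurable_fun setT X)
  (Xnu : forall V, measurable V -> P (X @^-1` V) = nu V).

Lemma ge0_integral_law (f : A -> \bar R) : measurable_fun setT f ->
  (forall a, 0 <= f a)%E -> (\int[P]_w f (X w) = \int[nu]_a f a)%E.
Proof.
move=> mf f0; transitivity (\int[pushforward P X]_a f a)%E.
  by rewrite ge0_integral_pushforward.
by apply: eq_measure_integral => V mV _; exact: Xnu.
Qed.

Lemma integrable_law (f : A -> R) : measurable_fun setT f ->
  nu.-integrable setT (EFin \o f) <-> P.-integrable setT (EFin \o (f \o X)).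
Proof.
move=> mf; have mf' : measurable_fun setT (fun a => `|(f a)%:E|)%E.
  by apply: measurableT_comp => //; exact/measurable_EFinP.
have mfX : measurable_fun setT (EFin \o (f \o X)).
  by apply/measurable_EFinP; exact: measurableT_comp mf mX.
split=> /integrableP[_ f_fin]; apply/integrableP; split => //.
- by rewrite (ge0_integral_law mf').
- exact/measurable_EFinP.
- by rewrite -(ge0_integral_law mf').
Qed.

Lemma Rintegral_law (f : A -> R) : measurable_fun setT f ->
  nu.-integrable setT (EFin \o f) -> \int[P]_w f (X w) = \int[nu]_a f a.
Proof.
move=> mf inuf; have /(integrable_law mf) iPf := inuf; congr fine.
transitivity (\int[pushforward P X]_a (f a)%:E)%E.
  by rewrite integral_pushforward//; exact/measurable_EFinP.
by apply: eq_measure_integral => V mV _; exact: Xnu.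
Qed.

End integral_law.

(** * The standard Gaussian law *)

Section gaussian.
Context {R : realType}.
Local Notation mu := (@lebesgue_measure R).
Local Notation gamma := (normal_prob (0:R) 1).

Lemma ge0_integral_normal_prob (m s : R) (f : R -> \bar R) :
  measurable_fun setT f -> (forall x, 0 <= f x)%E ->
  (\int[normal_prob m s]_x f x = \int[mu]_x (f x * (normal_pdf m s x)%:E))%E.
Proof.
move=> mf f0.
have dom := normal_prob_dominates m s.
rewrite -(Radon_Nikodym_SigmaFinite.change_of_variables dom)//=.
have intf := Radon_Nikodym_SigmaFinite.f_integrable dom.
apply: ae_eq_integral => //=.
- by apply: emeasurable_funM => //; exact: measurable_int intf.
- apply: emeasurable_funM => //; apply/measurable_EFinP.
  exact: measurable_normal_pdf.
- apply: ae_eqe_mul2l.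
  apply: integral_ae_eq => //.
  + apply/measurable_EFinP; exact: measurable_normal_pdf.
  + by move=> E _ mE; rewrite -(Radon_Nikodym_SigmaFinite.f_integral dom).
Qed.

Lemma ge0_integral_lebesgue_preserving (phi : R -> R) (f : R -> \bar R) :
  measurable_fun setT phi ->
  (forall a b, mu (phi @^-1` `]a, b]) = mu `]a, b]%classic) ->
  measurable_fun setT f -> (forall x, 0 <= f x)%E ->
  (\int[mu]_x f (phi x) = \int[mu]_x f x)%E.
Proof.
move=> mphi phiE mf f0.
have mphi' : @measurable_fun _ _ (measurableTypeR R) (measurableTypeR R) setT phi.
  exact: mphi.
transitivity
    (\int[pushforward mu (phi : measurableTypeR R -> measurableTypeR R)]_x f x)%E.
  by rewrite ge0_integral_pushforward.
apply: eq_measure_integral => //= A mA _; apply/esym.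
unshelve refine (@lebesgue_measure_unique R 
  (pushforward mu (phi : measurableTypeR R -> measurableTypeR R)) _ _ mA) => //.
by move=> _ [[a b] _ <-]; rewrite /= /pushforward phiE.
Qed.

Lemma ge0_integral_lebesgue_shift (u : R) (f : R -> \bar R) :
  measurable_fun setT f -> (forall x, 0 <= f x)%E ->
  (\int[mu]_x f (x + u)%R = \int[mu]_x f x)%E.
Proof.
apply: ge0_integral_lebesgue_preserving; first exact: measurable_funD.
move=> a b; have -> : (fun x : R => x + u) @^-1` `]a, b]%classic =
    `]a - u, b - u]%classic.
  by apply/seteqP; split => x /=; rewrite !in_itv/= ltrBlDr lerBrDr.
rewrite !lebesgue_measure_itv/= !lte_fin ltrD2r; case: ifP => // _.
by rewrite -!EFinB; congr (_%:E); ring.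
Qed.

Lemma ge0_integral_lebesgue_opp (f : R -> \bar R) :
  measurable_fun setT f -> (forall x, 0 <= f x)%E ->
  (\int[mu]_x f (- x)%R = \int[mu]_x f x)%E.
Proof.
apply: ge0_integral_lebesgue_preserving; first exact: oppr_measurable.
move=> a b; have -> : (fun x : R => - x) @^-1` `]a, b]%classic =
    `[- b, - a[%classic.
  by apply/seteqP; split => x /=; rewrite !in_itv/= ltrNr lerNl andbC.
rewrite !lebesgue_measure_itv/= !lte_fin ltrN2; case: ifP => // _.
by rewrite -!EFinB; congr (_%:E); ring.
Qed.

Lemma normal_pdf_shift (u x : R) :
  normal_pdf 0 1 (x - u) = expR (u * x - u ^+ 2 / 2) * normal_pdf 0 1 x.
Proof.
rewrite !normal_pdfE ?oner_neq0// mulrCA /normal_fun -expRD.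
by congr (_ * expR _); rewrite expr1n; field.
Qed.

Lemma normal_pdf_opp (x : R) : normal_pdf 0 1 (- x) = normal_pdf 0 1 x.
Proof. by rewrite !normal_pdfE ?oner_neq0// /normal_fun !subr0 sqrrN. Qed.

Lemma ge0_gauss_shift (u : R) (f : R -> \bar R) :
  measurable_fun setT f -> (forall x, 0 <= f x)%E ->
  (\int[gamma]_x f (x + u)%R =
   \int[gamma]_x (f x * (expR (u * x - u ^+ 2 / 2))%:E))%E.
Proof.
move=> mf f0.
have mD : measurable_fun [set: R] (fun x : R => x + u) by exact: measurable_funD.
have mp : measurable_fun [set: R] (fun x => (normal_pdf 0 1 x)%:E).
  by apply/measurable_EFinP; exact: measurable_normal_pdf.
have me : measurable_fun [set: R] (fun x : R => (expR (u * x - u ^+ 2 / 2))%:E).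
  apply/measurable_EFinP; apply: measurableT_comp => //.
  by apply: measurable_funB => //; exact: measurable_funM.
rewrite ge0_integral_normal_prob//; last exact: measurableT_comp mf mD.
rewrite ge0_integral_normal_prob//; first last.
- by move=> x; rewrite mule_ge0// lee_fin expR_ge0.
- exact: emeasurable_funM.
rewrite -[RHS](@ge0_integral_lebesgue_shift u); first last.
- by move=> x; rewrite !mule_ge0// lee_fin ?expR_ge0 ?normal_pdf_ge0.
- by apply: emeasurable_funM => //; exact: emeasurable_funM.
apply: eq_integral => x _.
by rewrite -muleA -EFinM -normal_pdf_shift addrK.
Qed.

Lemma ge0_gauss_opp (f : R -> \bar R) :
  measurable_fun setT f -> (forall x, 0 <= f x)%E ->
  (\int[gamma]_x f (- x)%R = \int[gamma]_x f x)%E.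
Proof.
move=> mf f0.
have mD : measurable_fun [set: R] (fun x : R => - x) by exact: oppr_measurable.
have mp : measurable_fun [set: R] (fun x => (normal_pdf 0 1 x)%:E).
  by apply/measurable_EFinP; exact: measurable_normal_pdf.
rewrite ge0_integral_normal_prob//; last exact: measurableT_comp mf mD.
rewrite ge0_integral_normal_prob// -[RHS]ge0_integral_lebesgue_opp.
- by apply: eq_integral => x _; rewrite normal_pdf_opp.
- exact: emeasurable_funM.
- by move=> x; rewrite !mule_ge0// lee_fin ?normal_pdf_ge0.
Qed.

End gaussian.

Section gaussian_moments.
Context {R : realType}.
Local Notation gamma := (normal_prob (0:R) 1).

Lemma measurable_expR_linear (u v : R) :
  measurable_fun [set: R] (fun x => expR (u * x - v)).
Proof. by apply: measurableT_comp => //; exact: measurable_funB. Qed.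

Lemma gauss_shift (u : R) (f : R -> R) : measurable_fun setT f ->
  \int[gamma]_x f (x + u) = \int[gamma]_x (f x * expR (u * x - u ^+ 2 / 2)).
Proof.
move=> mf; congr fine; rewrite [LHS]integralE [RHS]integralE.
have mp : measurable_fun setT ((EFin \o f)^\+)%E.
  by apply/measurable_funepos/measurable_EFinP.
have mn : measurable_fun setT ((EFin \o f)^\-)%E.
  by apply/measurable_funeneg/measurable_EFinP.
congr (_ - _)%E.
- transitivity (\int[gamma]_x (EFin \o f)^\+%E (x + u)%R)%E.
    by apply: eq_integral => x _; rewrite !funeposE.
  rewrite ge0_gauss_shift//; apply: eq_integral => x _.
  by rewrite !funeposE -!EFin_max -EFinM maxr_pMl ?expR_ge0// mul0r.
- transitivity (\int[gamma]_x (EFin \o f)^\-%E (x + u)%R)%E.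
    by apply: eq_integral => x _; rewrite !funenegE.
  rewrite ge0_gauss_shift//; apply: eq_integral => x _.
  by rewrite !funenegE -!EFin_max -EFinM maxr_pMl ?expR_ge0// mul0r mulNr.
Qed.

Lemma gauss_expR (u : R) :
  (\int[gamma]_x (expR (u * x))%:E = (expR (u ^+ 2 / 2))%:E)%E.
Proof.
have := @ge0_gauss_shift R u (cst 1%E) (measurable_cst _) (fun=> lee01).
rewrite integral_cst//= mul1e probability_setT => h.
transitivity (\int[gamma]_x ((expR (u ^+ 2 / 2))%:E *
    (1 * (expR (u * x - u ^+ 2 / 2))%:E)))%E.
  apply: eq_integral => x _.
  by rewrite mul1e -EFinM -expRD addrCA subrr addr0.
rewrite ge0_integralZl//.
- by rewrite -h mule1.
- under eq_fun do rewrite mul1e.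
  apply/measurable_EFinP; exact: measurable_expR_linear.
Qed.

Lemma integrable_gauss_expR (u : R) :
  gamma.-integrable setT (EFin \o (fun x => expR (u * x))).
Proof.
apply/integrableP; split.
  by apply/measurable_EFinP; apply: measurableT_comp.
under eq_integral do rewrite /= ger0_norm ?expR_ge0//.
by rewrite /= gauss_expR ltry.
Qed.

Lemma integrable_gauss_expR_norm (u : R) : 0 <= u ->
  gamma.-integrable setT (EFin \o (fun x => expR (u * `|x|))).
Proof.
move=> u0; apply: (@le_integrable_EFin _ (measurableTypeR R) R gamma _
    (fun x : R => expR (u * x) + expR (- u * x))) => /=.
- by apply: measurableT_comp => //; exact: measurable_funM.
- move=> x; rewrite ger0_norm ?expR_ge0// mulNr.
  by case: (ger0P x) => _; rewrite ?mulrN ?lerDl ?lerDr expR_ge0.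
- exact: integrableD (integrable_gauss_expR _) (integrable_gauss_expR _).
Qed.

Lemma sqr_le_cosh (y : R) : 3 * y ^+ 2 <= 4 * (expR y + expR (- y) - 2).
Proof.
wlog y0 : y / 0 <= y => [h|].
  have [|/ltW y0] := leP 0 y; first exact: h.
  by have := h (- y); rewrite sqrrN opprK oppr_ge0 [expR (- y) + _]addrC; exact.
set a := 1 + y / 4; set b := expR (y / 2); set c := expR (- (y / 2)).
have bc : b * c = 1 by rewrite /b /c -expRD subrr expR0.
have b0 : 0 < b := expR_gt0 _.
have -> : expR y = b ^+ 2 by rewrite -expRM_natl; congr expR; field.
have -> : expR (- y) = c ^+ 2 by rewrite -expRM_natl; congr expR; field.
have ab : a ^+ 2 <= b.
  have -> : b = expR (y / 4) ^+ 2 by rewrite -expRM_natl; congr expR; field.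
  have := expR_ge1Dx (y / 4); rewrite -/a => ha.
  by rewrite lerXn2r// ?nnegrE ?expR_ge0// /a; lra.
have a1 : 1 <= a by rewrite /a; lra.
have a3 : 7 / 2 * a ^+ 2 <= (a + 1) * (a ^+ 2 + 1).
  have : 0 <= (a + 1 / 2) * (a - 3 / 2) ^+ 2 by rewrite mulr_ge0 ?sqr_ge0; lra.
  by nra.
have : 7 / 2 * (a - 1) <= b - c.
  set k := 7 / 2 * (a - 1); set s := a ^+ 2 in ab a3.
  have sk : 0 <= s ^+ 2 - k * s - 1.
    have -> : s ^+ 2 - k * s - 1 = (a - 1) * ((a + 1) * (s + 1) - 7 / 2 * s).
      by rewrite /k /s; ring.
    by rewrite mulr_ge0// subr_ge0.
  have s0 : 0 < s by rewrite exprn_gt0// (lt_le_trans ltr01).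
  have ks : k <= s.
    have : 0 <= (s - k) * s by rewrite mulrBl -expr2; lra.
    by rewrite pmulr_lge0// subr_ge0.
  have : 0 <= (b - c - k) * b.
    have -> : (b - c - k) * b = (b - s) * (b + s - k) + (s ^+ 2 - k * s - 1).
      by rewrite !mulrBl (mulrC c) bc; ring.
    by rewrite addr_ge0// mulr_ge0 ?subr_ge0//; lra.
  by rewrite pmulr_lge0//; lra.
rewrite (_ : a - 1 = y / 4); last by rewrite /a; ring.
by nra.
Qed.

Lemma integrable_gauss_sqr : gamma.-integrable setT (EFin \o (fun x : R => x ^+ 2)).
Proof.
apply: (@le_integrable_EFin _ (measurableTypeR R) R gamma _
    (fun x : R => 2 * expR (1 * `|x|))) => /=.
- exact: measurable_funX.
- move=> x; rewrite mul1r ger0_norm ?sqr_ge0//.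
  have := expR_ge1Dxn 1 (normr_ge0 x); rewrite real_normK ?num_real//.
  by rewrite !factS fact0; lra.
- exact: integrable_EFinZ (integrable_gauss_expR_norm ler01).
Qed.

Lemma Rintegral_gauss_expR (u : R) :
  \int[gamma]_x expR (u * x) = expR (u ^+ 2 / 2).
Proof. by rewrite /Rintegral gauss_expR. Qed.

(* The exact value is 1; any bound up to 2 fits the factor 4 of the theorem. *)
Lemma gauss_sqr_le2 : \int[gamma]_x (x ^+ 2) <= 2.
Proof.
have i0 u := @integrable_gauss_expR u.
have i1 := integrable_EFinD (i0 1) (i0 (- 1)).
have i2 := integrable_EFinZ 4 i1.
have i3 : gamma.-integrable setT (EFin \o cst (8 : R)).
  exact: finite_measure_integrable_cst.
have : \int[gamma]_x (3 * x ^+ 2) <=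
    \int[gamma]_x (4 * (expR (1 * x) + expR (- 1 * x)) - cst 8 x).
  apply: le_Rintegral => //.
  - exact: integrable_EFinZ integrable_gauss_sqr.
  - exact: integrable_EFinB i2 i3.
  - by move=> x _; have := sqr_le_cosh x; rewrite mul1r mulN1r /=; lra.
rewrite RintegralZl//; last exact: integrable_gauss_sqr.
rewrite RintegralB// RintegralZl// RintegralD//.
rewrite !Rintegral_gauss_expR sqrrN expr1n Rintegral_cst//.
rewrite [X in fine X](@probability_setT _ _ _ gamma) mulr1.
set e := expR (1 / 2).
have : e * (7 / 8) ^+ 4 <= 1.
  have eE : e * expR (- (1 / 8)) ^+ 4 = 1.
    by rewrite -expRM_natl -expRD -[RHS]expR0; congr expR; field.
  rewrite -[leRHS]eE.
  rewrite ler_wpM2l ?expR_ge0// lerXn2r ?nnegrE ?expR_ge0//.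
  by have := expR_ge1Dx (- (1 / 8) : R); lra.
by lra.
Qed.

End gaussian_moments.

Section gaussian_opp.
Context {R : realType}.
Local Notation gamma := (normal_prob (0:R) 1).

Lemma normal_prob_opp (V : set R) : measurable V -> gamma (-%R @^-1` V) = gamma V.
Proof.
move=> mV; have mV' : measurable (-%R @^-1` V).
  by rewrite -[_ @^-1` _]setTI; exact: oppr_measurable.
have intE W : measurable W -> (\int[gamma]_x (\1_W x)%:E)%E = gamma W.
  by move=> mW; rewrite integral_indic// setIT.
rewrite -(intE _ mV) -(intE _ mV') -(@ge0_gauss_opp R (EFin \o \1_V))//.
- by apply/measurable_EFinP; exact: measurable_indic.
- by move=> x; rewrite /= lee_fin.
Qed.

Lemma integrable_gauss_id : gamma.-integrable setT (EFin \o (fun y : R => y)).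
Proof.
apply: (@integrable_of_sqr _ _ (measurableTypeR R) gamma) => //.
exact: integrable_gauss_sqr.
Qed.

End gaussian_opp.

Section gaussian_smoothing.
Context {R : realType}.
Local Notation gamma := (normal_prob (0:R) 1).

Let le_integrable_gauss := @le_integrable_EFin _ (measurableTypeR R) R gamma.
Let norm_Rintegral_gauss_le := @norm_Rintegral_le _ (measurableTypeR R) R gamma.

Lemma expR_taylor1 (w : R) : `|expR w - 1 - w| <= w ^+ 2 * expR `|w|.
Proof.
have h1 := expR_ge1Dx w.
have h2 : expR w - 1 <= w * expR w.
  have : (1 - w) * expR w <= 1.
    rewrite -[leRHS](expRxMexpNx_1 w) mulrC ler_pM2l ?expR_gt0//.
    exact: expR_ge1Dx.
  by rewrite mulrBl; lra.
rewrite ger0_norm; last by lra.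
have [w0|w0] := leP 0 w.
- rewrite (@le_trans _ _ (w * (expR w - 1)))//; first by lra.
  by rewrite (ger0_norm w0) expr2 -mulrA ler_wpM2l.
- have e1 : 1 <= expR (- w) by rewrite -[leLHS]expR0 ler_expR; lra.
  rewrite (@le_trans _ _ (w * (expR w - 1)))//; first by lra.
  rewrite (@le_trans _ _ (w ^+ 2))//; first by nra.
  by rewrite (ltr0_norm w0) ler_peMr ?sqr_ge0.
Qed.

Lemma expR_gauss_taylor (u y : R) : `|u| <= 1 ->
  `|y| * `|expR (u * y - u ^+ 2 / 2) - 1 - u * y| <=
  u ^+ 2 * ((1 + expR 1) * expR (4 * `|y|)).
Proof.
move=> u1; set w := u * y - u ^+ 2 / 2; set t : R := `|y|.
have t0 : 0 <= t by exact: normr_ge0.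
have wu : `|w| <= `|u| * (1 + t).
  rewrite (le_trans (ler_normB _ _))// normrM -/t normrM normrX.
  have -> : `|2^-1| = 2^-1 :> R by rewrite ger0_norm.
  have := normr_ge0 u; nra.
have w1 : `|w| <= 1 + t.
  by rewrite (le_trans wu)// ler_piMl//; lra.
have t1 : 1 + t <= expR t := expR_ge1Dx t.
have w2 : w ^+ 2 <= u ^+ 2 * expR (2 * t).
  rewrite -real_normK ?num_real// -[u ^+ 2]real_normK ?num_real//.
  rewrite expRM_natl -exprMn lerXn2r ?nnegrE ?mulr_ge0 ?expR_ge0//.
  by rewrite (le_trans wu)// ler_wpM2l.
have ew : expR `|w| <= expR 1 * expR t by rewrite -expRD ler_expR.
have -> : expR w - 1 - u * y = (expR w - 1 - w) - u ^+ 2 / 2.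
  by rewrite /w; ring.
have h : `|expR w - 1 - w - u ^+ 2 / 2| <=
    u ^+ 2 * (expR (2 * t) * (expR 1 * expR t) + 1).
  rewrite (le_trans (ler_normB _ _))// mulrDr mulr1 lerD//.
    rewrite (le_trans (expR_taylor1 w))// mulrA ler_pM ?sqr_ge0 ?expR_ge0//.
  by rewrite ger0_norm ?divr_ge0 ?sqr_ge0// ler_pdivrMr// ler_peMr ?sqr_ge0//; lra.
rewrite (le_trans (ler_wpM2l t0 h))// mulrCA ler_wpM2l ?sqr_ge0//.
have -> : expR (4 * t) = expR t * (expR (2 * t) * expR t).
  by rewrite -!expRD; congr expR; ring.
have et1 : 1 <= expR (2 * t) * expR t.
  by rewrite -expRD -[leLHS]expR0 ler_expR; lra.
rewrite (mulrCA (1 + expR 1)) ler_pM ?addr_ge0 ?mulr_ge0 ?expR_ge0//; first by lra.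
by move: et1; move: (expR (2 * t)) (expR t) (expR 1) => a b c; lra.
Qed.

(* Changing measure from [y + u] to [y] replaces [N (y + u)] by
   [N y * expR (u * y - u ^+ 2 / 2)], and the exponential is expanded to first
   order in [u]; for [1 < `|u|] the Lipschitz bound suffices. *)
Lemma gauss_smoothing_unit : exists2 C : R, 0 < C &
  forall N : R -> R, measurable_fun setT N ->
    (forall x y, `|N x - N y| <= `|x - y|) ->
  forall u, `|\int[gamma]_y (N (y + u) - N y)
              - u * \int[gamma]_y ((N y - N 0) * y)| <= C * u ^+ 2.
Proof.
pose K := \int[gamma]_y expR (4 * `|y|).
have K0 : 0 <= K by apply: Rintegral_ge0 => y _; exact: expR_ge0.
have e1 : 0 < 1 + expR 1 :> R by rewrite addr_gt0 ?expR_gt0.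
exists (3 + (1 + expR 1) * K); first by rewrite ltr_wpDr ?mulr_ge0// ltW.
move=> N mN lipN u.
have mNy : measurable_fun setT (fun y : R => (N y - N 0) * y).
  by apply: measurable_funM => //; exact: measurable_funB.
have mNu : measurable_fun setT (fun y : R => N (y + u)).
  by apply: measurableT_comp mN _; exact: measurable_funD.
have Nyb (y : R) : `|(N y - N 0) * y| <= y ^+ 2.
  rewrite normrM -[leRHS]ger0_norm ?sqr_ge0// expr2 normrM ler_wpM2r//.
  by rewrite (le_trans (lipN _ _))// subr0.
have iNy := le_integrable_gauss mNy Nyb integrable_gauss_sqr.
have [u1|u1] := leP `|u| 1; last first.
  have uu : `|u| <= u ^+ 2.
    by rewrite -[u ^+ 2]real_normK ?num_real// expr2 ler_peMl// ltW.
  rewrite (le_trans (ler_normB _ _))// mulrDl ler_wpDr//.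
    by rewrite mulr_ge0 ?sqr_ge0// mulr_ge0// ltW.
  rewrite (_ : 3 * u ^+ 2 = u ^+ 2 + u ^+ 2 * 2); last by ring.
  rewrite lerD//.
    rewrite (@le_trans _ _ `|u|)//.
    rewrite (le_trans (@norm_Rintegral_gauss_le _ (cst `|u|) _ _ _))//.
    - exact: measurable_funB.
    - by move=> y; rewrite (le_trans (lipN _ _))// addrAC subrr add0r.
    - exact: finite_measure_integrable_cst.
    - by rewrite Rintegral_cst// [X in fine X](@probability_setT _ _ _ gamma) mulr1.
  rewrite normrM ler_pM//.
  rewrite (le_trans (norm_Rintegral_gauss_le mNy Nyb integrable_gauss_sqr))//.
  exact: gauss_sqr_le2.
pose N' y := N y - N 0.
pose D y := N' y * (expR (u * y - u ^+ 2 / 2) - 1 - u * y).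
have mN' : measurable_fun setT N' by exact: measurable_funB.
have mD : measurable_fun setT D.
  apply: measurable_funM => //; apply: measurable_funB; last exact: measurable_funM.
  by apply: measurable_funB => //; exact: measurable_expR_linear.
have N'b (y : R) : `|N' y| <= `|y| by rewrite (le_trans (lipN _ _))// subr0.
have iE : gamma.-integrable setT
    (EFin \o (fun y : R => u ^+ 2 * ((1 + expR 1) * expR (4 * `|y|)))).
  by apply/integrable_EFinZ/integrable_EFinZ/integrable_gauss_expR_norm.
have Db y : `|D y| <= u ^+ 2 * ((1 + expR 1) * expR (4 * `|y|)).
  by rewrite normrM (le_trans _ (expR_gauss_taylor y u1))// ler_wpM2r.
have iD := le_integrable_gauss mD Db iE.
have inorm : gamma.-integrable setT (EFin \o (fun y : R => expR (1 * `|y|))).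
  exact: integrable_gauss_expR_norm.
have yexp (y : R) : `|y| <= expR (1 * `|y|).
  by have := expR_ge1Dx `|y|; rewrite mul1r; lra.
have iN' : gamma.-integrable setT (EFin \o N').
  by apply: le_integrable_gauss mN' _ inorm => y; exact: le_trans (N'b y) (yexp y).
have iN'u : gamma.-integrable setT (EFin \o (fun y : R => N' (y + u))).
  have h : gamma.-integrable setT (EFin \o (fun y : R => expR (1 * `|y|) + cst 1 y)).
    by apply: integrable_EFinD => //; exact: finite_measure_integrable_cst.
  apply: le_integrable_gauss h; first exact: measurable_funB.
  move=> y; rewrite (le_trans (N'b _))// (le_trans (ler_normD _ _))// lerD//.
have -> : \int[gamma]_y (N (y + u) - N y) =
    \int[gamma]_y N' (y + u) - \int[gamma]_y N' y.
  rewrite -RintegralB//; apply: eq_Rintegral => y _.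
  by rewrite /N' opprB addrA subrK.
rewrite gauss_shift//.
have -> : \int[gamma]_y (N' y * expR (u * y - u ^+ 2 / 2)) =
   \int[gamma]_y (D y + (N' y + u * (N' y * y))).
  by apply: eq_Rintegral => y _; rewrite /D; ring.
rewrite RintegralD//; last by apply: integrable_EFinD => //; exact: integrable_EFinZ.
rewrite RintegralD//; last exact: integrable_EFinZ.
rewrite RintegralZl// -/(N' _).
have cancel (a b c : R) : a + (b + c) - b - c = a by ring.
rewrite cancel.
rewrite (le_trans (norm_Rintegral_gauss_le mD Db iE))//.
rewrite RintegralZl//; last by apply/integrable_EFinZ/integrable_gauss_expR_norm.
rewrite RintegralZl//; last exact/integrable_gauss_expR_norm.
by rewrite mulrC ler_wpM2r ?sqr_ge0// lerDr.
Qed.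

End gaussian_smoothing.

Section gaussian_smoothing_scaled.
Context {R : realType}.
Local Notation gamma := (normal_prob (0:R) 1).

Definition gauss_smoothing_bound (C : R) :=
  forall M : R -> R, measurable_fun setT M ->
    (forall x y, `|M x - M y| <= `|x - y|) ->
  forall theta x : R, 0 < theta ->
  `|\int[gamma]_y (M (x + theta * y) - M (theta * y))
    - (theta^-1 * \int[gamma]_y ((M (theta * y) - M 0) * y)) * x|
  <= C / theta * x ^+ 2.

Lemma gauss_smoothing : exists2 C : R, 0 < C & gauss_smoothing_bound C.
Proof.
have [C C0 CP] := @gauss_smoothing_unit R.
exists C => // M mM lipM theta x t0.
have t1 : theta != 0 by rewrite gt_eqF.
have ti : 0 < theta^-1 by rewrite invr_gt0.
pose N y := theta^-1 * M (theta * y).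
have mN : measurable_fun setT N.
  by apply: measurable_funM => //; apply: measurableT_comp mM _; exact: measurable_funM.
have lipN a b : `|N a - N b| <= `|a - b|.
  rewrite -mulrBr normrM gtr0_norm// ler_pdivrMl//.
  by rewrite (le_trans (lipM _ _))// -mulrBr normrM gtr0_norm.
have mscal (f : R -> R) : measurable_fun setT f ->
  (forall y, `|f y| <= `|x| + theta * y ^+ 2) -> gamma.-integrable setT (EFin \o f).
  move=> mf fb; apply: (@le_integrable_EFin _ (measurableTypeR R) R gamma _ _ mf fb).
  apply: integrable_EFinD; first exact: finite_measure_integrable_cst.
  exact: integrable_EFinZ integrable_gauss_sqr.
have mMt : measurable_fun setT (fun y => M (theta * y)).
  by apply: measurableT_comp mM _; exact: measurable_funM.
have i1 : gamma.-integrable setT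
    (EFin \o (fun y : R => M (x + theta * y) - M (theta * y))).
  apply: mscal.
    apply: measurable_funB => //; apply: measurableT_comp mM _.
    by apply: measurable_funD => //; exact: measurable_funM.
  move=> y; rewrite (le_trans (lipM _ _))// addrK lerDl mulr_ge0 ?sqr_ge0//.
  exact: ltW.
have i2 : gamma.-integrable setT (EFin \o (fun y : R => (M (theta * y) - M 0) * y)).
  apply: mscal.
    by apply: measurable_funM => //; exact: measurable_funB.
  move=> y; rewrite normrM (@le_trans _ _ (theta * y ^+ 2)) ?lerDr//.
  rewrite -[y ^+ 2]real_normK ?num_real// expr2 mulrA ler_wpM2r//.
  by rewrite (le_trans (lipM _ _))// subr0 normrM gtr0_norm.
have := CP N mN lipN (theta^-1 * x).
have -> : \int[gamma]_y (N (y + theta^-1 * x) - N y) =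
    theta^-1 * \int[gamma]_y (M (x + theta * y) - M (theta * y)).
  rewrite -RintegralZl//; apply: eq_Rintegral => /= y _.
  rewrite /N -mulrBr; congr (_ * (M _ - _)).
  by rewrite mulrDr mulrA mulfV// mul1r addrC.
have -> : \int[gamma]_y ((N y - N 0) * y) =
    theta^-1 * \int[gamma]_y ((M (theta * y) - M 0) * y).
  rewrite -RintegralZl//; apply: eq_Rintegral => y _.
  by rewrite /N mulr0 -mulrBr -mulrA.
move: (\int[gamma]_y _) (\int[gamma]_y _) => J I.
have -> : theta^-1 * I - theta^-1 * x * (theta^-1 * J) =
  theta^-1 * (I - theta^-1 * J * x) by ring.
rewrite normrM gtr0_norm// ler_pdivrMl// => /le_trans; apply.
by rewrite le_eqVlt; apply/orP; left; apply/eqP; field.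
Qed.

End gaussian_smoothing_scaled.

(** * Independence *)

Definition independent {R : realType} {d dA dB} {T : measurableType d}
    {A : measurableType dA} {B : measurableType dB} (P : probability T R)
    (X : T -> A) (Y : T -> B) :=
  forall U V, measurable U -> measurable V ->
    P (X @^-1` U `&` Y @^-1` V) = (P (X @^-1` U) * P (Y @^-1` V))%E.

Lemma independent_comp {R : realType} {d dA dA' dB} {T : measurableType d}
    {A : measurableType dA} {A' : measurableType dA'} {B : measurableType dB}
    (P : probability T R) (X : T -> A) (Y : T -> B) (f : A -> A') :
  measurable_fun setT f -> independent P X Y -> independent P (f \o X) Y.
Proof.
move=> mf XY U V mU mV; apply: (XY (f @^-1` U)) => //.
by rewrite -[_ @^-1` _]setTI; exact: mf.
Qed.

Lemma mutually_independent_comp {R : realType} {d dV dV'} {T : measurableType d}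
    {V : measurableType dV} {V' : measurableType dV'} (P : probability T R)
    (I : finType) (X : I -> T -> V) (Y : I -> T -> V') (f : I -> V -> V') :
  (forall i, measurable_fun setT (f i)) -> (forall i w, Y i w = f i (X i w)) ->
  mutually_independent P X -> mutually_independent P Y.
Proof.
move=> mf YE indX B mB.
have -> : Y = fun i w => f i (X i w) by apply/funext => i; apply/funext.
apply: (indX (fun i => f i @^-1` B i)) => i.
by rewrite -[_ @^-1` _]setTI; exact: mf.
Qed.

Section independent_integral.
Context {R : realType} {d dA dB} {T : measurableType d}
  {A : measurableType dA} {B : measurableType dB}.
Variables (P : probability T R) (X : T -> A) (Y : T -> B).
Hypotheses (mX : measurable_fun setT X) (mY : measurable_fun setT Y).
Hypothesis XY : independent P X Y.
Variable nu : probability B R.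
Hypothesis Ynu : forall V, measurable V -> P (Y @^-1` V) = nu V.

Variable g : A * B -> R.
Hypotheses (mg : measurable_fun setT g)
  (ig : P.-integrable setT (EFin \o (fun w => g (X w, Y w))))
  (inu : forall a, nu.-integrable setT (EFin \o (fun y => g (a, y)))).

Let mXc := isMeasurableFun.Build _ _ _ _ _ mX.
Let rX : {mfun T >-> A} := HB.pack X mXc.
Let Z w := (X w, Y w).
Let mZ : measurable_fun setT Z.
Proof. exact: measurable_fun_pair. Qed.

Let lawE E : measurable E -> (distribution P rX \x nu)%E E = pushforward P Z E.
Proof.
move=> mE.
unshelve refine (@product_measure_unique _ _ _ _ _ (distribution P rX) nu
  (pushforward P Z) _ _ mE).
  exact: mZ.
by move=> U V mU mV; rewrite [LHS](XY mU mV) (Ynu mV).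
Qed.

Let ip : (distribution P rX \x nu)%E.-integrable setT (EFin \o g).
Proof.
apply/integrableP; split; first exact/measurable_EFinP.
rewrite (eq_measure_integral (pushforward P Z)); last first.
  by move=> E mE _; exact: lawE.
have mabs : measurable_fun setT (fun x => `|(EFin \o g) x|)%E.
  by apply: measurableT_comp => //; exact/measurable_EFinP.
by rewrite ge0_integral_pushforward//; case/integrableP : ig.
Qed.

Let FE : fubini_F nu (EFin \o g) = EFin \o (fun a => \int[nu]_y g (a, y)).
Proof.
apply/funext => a; rewrite /fubini_F/= /Rintegral fineK//.
exact: integrable_fin_num (inu a).
Qed.

Lemma measurable_Rintegral_fubini :
  measurable_fun setT (fun a => \int[nu]_y g (a, y)).
Proof. by apply/measurable_EFinP; have := measurable_fubini_F ip; rewrite FE. Qed.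

Lemma integrable_independent :
  P.-integrable setT (EFin \o (fun w => \int[nu]_y g (X w, y))).
Proof.
have := integrable_fubini_F ip; rewrite FE => /integrableP[mF F_fin].
apply/integrableP; split; first exact: measurableT_comp mF mX.
by move: F_fin; rewrite ge0_integral_pushforward//; exact: measurableT_comp.
Qed.

Lemma Rintegral_independent :
  \int[P]_w g (X w, Y w) = \int[P]_w \int[nu]_y g (X w, y).
Proof.
congr fine.
transitivity (\int[pushforward P Z]_z (g z)%:E)%E.
  by rewrite integral_pushforward//; exact/measurable_EFinP.
transitivity (\int[(distribution P rX \x nu)%E]_z (g z)%:E)%E.
  by apply/esym/eq_measure_integral => E mE _; exact: lawE.
rewrite -integral12_prod_meas1// FE integral_pushforward//.
- by apply/measurable_EFinP; exact: measurable_Rintegral_fubini.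
- exact: integrable_independent.
Qed.

End independent_integral.

Section independent_product.
Context {R : realType} {d} {T : measurableType d} (P : probability T R).

Lemma Rintegral_independentM (X Y : T -> R) :
  measurable_fun setT X -> measurable_fun setT Y -> independent P X Y ->
  P.-integrable setT (EFin \o X) -> P.-integrable setT (EFin \o Y) ->
  P.-integrable setT (EFin \o (fun w => X w * Y w)) ->
  \int[P]_w (X w * Y w) = (\int[P]_w X w) * (\int[P]_w Y w).
Proof.
move=> mX mY XY iX iY iXY.
pose mYc := isMeasurableFun.Build _ _ _ _ _ mY.
pose rY : {RV P >-> R} := HB.pack Y mYc.
have iid : (distribution P rY).-integrable setT (EFin \o (fun y : R => y)).
  by apply: integrable_pushforward => //; exact/measurable_EFinP.
have Eid : \int[distribution P rY]_y y = \int[P]_w Y w.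
  by rewrite /Rintegral integral_pushforward//; exact/measurable_EFinP.
rewrite (@Rintegral_independent _ _ _ _ _ R R P X Y mX mY XY (distribution P rY) _
  (fun z => z.1 * z.2))//=.
- under eq_Rintegral do rewrite RintegralZl// Eid.
  by rewrite RintegralZr.
- by apply: measurable_funM; [exact: measurable_fst|exact: measurable_snd].
- by move=> a; exact: integrable_EFinZ iid.
Qed.

End independent_product.

Section cylinders.
Context {d dV} {T : measurableType d} {V : measurableType dV} {I : finType}.
Implicit Types (Z : I -> T -> V) (S : pred I).

(* The identity from [T] to [T] with the sigma-algebra generated by [cylinders Z S]
   stands for the subfamily of the [Z i] with [i] in [S]. *)
Definition cylinders Z S : set (set T) :=
  [set E | exists2 B : I -> set V, (forall i, measurable (B i)) &
     E = \bigcap_(i in [set i | S i]) Z i @^-1` B i].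

Local Notation cylType Z S := (g_sigma_algebraType (cylinders Z S)).

Lemma setI_closed_cylinders Z S : setI_closed (cylinders Z S).
Proof.
move=> _ _ [B mB ->] [C mC ->]; exists (fun i => B i `&` C i).
  by move=> i; exact: measurableI.
rewrite -bigcapI; by apply: eq_bigcapr => i _.
Qed.

Lemma cylindersT Z S : cylinders Z S setT.
Proof.
exists (fun=> setT) => //; apply/esym.
by rewrite -subTset => w _ i _.
Qed.

Lemma cylinders_sub Z S S' : {subset S <= S'} -> cylinders Z S `<=` cylinders Z S'.
Proof.
move=> SS' _ [B mB ->]; exists (fun i => if S i then B i else setT).
  by move=> i; case: ifP.
apply/seteqP; split => w Bw i /= Si.
  by case: ifPn => // Si'; exact: Bw.
by have := Bw i (SS' i Si); rewrite /= Si.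
Qed.

Lemma cylinders_measurable Z S : (forall i, measurable_fun setT (Z i)) ->
  cylinders Z S `<=` measurable.
Proof.
move=> mZ _ [B mB ->]; apply: fin_bigcap_measurable.
  exact: finite_finset.
by move=> i _; rewrite -[_ @^-1` _]setTI; exact: mZ.
Qed.

Lemma measurable_id_cylinders Z S : (forall i, measurable_fun setT (Z i)) ->
  @measurable_fun _ _ T (cylType Z S) setT id.
Proof.
move=> mZ.
apply: (@measurability _ _ T (cylType Z S) setT id (cylinders Z S)) => //.
move=> _ [E /(cylinders_measurable mZ) mE <-].
by rewrite setTI.
Qed.

Lemma measurable_id_cylinders_sub Z S S' : {subset S <= S'} ->
  @measurable_fun _ _ (cylType Z S') (cylType Z S) setT id.
Proof.
move=> SS'.
apply: (@measurability _ _ (cylType Z S') (cylType Z S) setT id (cylinders Z S)) => //.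
move=> _ [E /(cylinders_sub SS') CE <-].
by rewrite setTI; exact: sub_sigma_algebra.
Qed.

Lemma measurable_cylinders Z S i : S i ->
  @measurable_fun _ _ (cylType Z S) V setT (Z i).
Proof.
move=> Si _ B mB; rewrite setTI; apply: sub_sigma_algebra.
exists (fun j => if j == i then B else setT) => [j|]; first by case: ifP.
apply/seteqP; split => [w Bw j /= _|w /(_ i Si) /=]; last by rewrite eqxx.
by case: ifP => // /eqP ->.
Qed.

End cylinders.
Arguments cylinders {d dV T V I}.
Notation cylType Z S := (g_sigma_algebraType (cylinders Z S)).

Section independent_cylinders.
Context {R : realType} {d dV} {T : measurableType d} {V : measurableType dV}
  {I : finType}.
Variables (P : probability T R) (Z : I -> T -> V).
Hypotheses (mZ : forall i, measurable_fun setT (Z i))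
  (indZ : mutually_independent P Z).

Let cyl (S : pred I) (B : I -> set V) := \bigcap_(i in [set i | S i]) Z i @^-1` B i.

Lemma probability_cylinder S B : (forall i, measurable (B i)) ->
  P (cyl S B) = (\prod_(i | S i) P (Z i @^-1` B i))%E.
Proof.
move=> mB; pose B' i := if S i then B i else setT.
have -> : cyl S B = \bigcap_i (Z i @^-1` B' i).
  apply/seteqP; split => w Bw i /= => [_|Si].
    by rewrite /B'; case: ifPn => // Si; exact: Bw.
  by have := Bw i Logic.I; rewrite /B' /= Si.
rewrite indZ; last by move=> i; rewrite /B'; case: ifP.
rewrite [RHS]big_mkcond/=; apply: eq_bigr => i _; rewrite /B'.
by case: ifP => // _; rewrite preimage_setT probability_setT.
Qed.

Lemma independent_cylinders S k : ~~ S k ->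
  @independent _ _ _ _ T (cylType Z S) V P id (Z k).
Proof.
move=> Sk U B mU mB.
have mZB : measurable (Z k @^-1` B) by rewrite -[_ @^-1` _]setTI; exact: mZ.
pose r : {nonneg R} := NngNum (fine_ge0 (measure_ge0 P (Z k @^-1` B))).
have rE : r%:num%:E = P (Z k @^-1` B) by rewrite fineK// fin_num_measure.
rewrite preimage_id muleC -rE.
apply: (@g_sigma_algebra_measure_unique _ R T (cylinders Z S) _ (fun=> setT) _ _
  (mrestr P mZB) (mscale r P)) => //.
- exact: cylinders_measurable.
- by move=> _; exact: cylindersT.
- by rewrite bigcup_const//; exists 0%N.
- exact: setI_closed_cylinders.
- move=> _ [C mC ->].
  transitivity (P (Z k @^-1` B) * P (cyl S C))%E; last by rewrite -rE.
  rewrite /= /mrestr -/(cyl S C) (probability_cylinder S)//.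
  pose C' i := if i == k then B else C i.
  have -> : cyl S C `&` Z k @^-1` B = cyl (predU1 k S) C'.
    apply/seteqP; split => w /=.
      move=> [Cw Bw] i /= /orP[/eqP ->|Si]; rewrite /C'; first by rewrite eqxx.
      by case: eqP => [->//|_]; exact: Cw.
    move=> Cw; split=> [i /= Si|].
      have := Cw i; rewrite /= /C' Si orbT => /(_ isT).
      by case: eqP => // ik; rewrite -ik Si in Sk.
    by have := Cw k; rewrite /= /C' eqxx; exact.
  rewrite probability_cylinder; last by move=> i; rewrite /C'; case: ifP.
  rewrite (bigD1 k)/= ?eqxx// /C' eqxx; congr (_ * _)%E.
  apply: eq_big => [i|i /andP[_ /negbTE ->]//].
  by case: eqP => [->|]; rewrite ?(negbTE Sk) //= andbT.
- by move=> _; rewrite -ge0_fin_numE//; exact: fin_num_measure.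
Qed.

End independent_cylinders.

Lemma independent_pair {R : realType} {d dV} {T : measurableType d}
    {V : measurableType dV} {I : finType} (P : probability T R) (Z : I -> T -> V) i k :
  (forall i, measurable_fun setT (Z i)) -> mutually_independent P Z ->
  i != k -> independent P (Z i) (Z k).
Proof.
move=> mZ indZ ik.
apply: (@independent_comp _ _ _ _ _ T (cylType Z (pred1 i)) V V P id _ (Z i)).
  by apply: measurable_cylinders; exact: eqxx.
by apply: independent_cylinders => //=; rewrite eq_sym.
Qed.

Section second_moments.
Context {R : realType} {d} {T : measurableType d} (P : probability T R).

Context {A : choiceType} (xi : A -> T -> R).
Hypotheses (mxi : forall a, measurable_fun setT (xi a))
  (indxi : forall a c, a != c -> independent P (xi a) (xi c))
  (Exi : forall a, \int[P]_w xi a w = 0)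
  (ixi : forall a, P.-integrable setT (EFin \o (fun w => xi a w ^+ 2))).

Lemma integrable_sqr_sum (s : seq A) :
  P.-integrable setT (EFin \o (fun w => (\sum_(a <- s) xi a w) ^+ 2)).
Proof.
elim: s => [|a s ih].
  under eq_fun do rewrite big_nil expr0n/=.
  exact: finite_measure_integrable_cst.
under eq_fun do rewrite big_cons.
by apply: integrable_sqrD => //; exact: measurable_sum.
Qed.

Lemma Rintegral_sqr_sum (s : seq A) : uniq s ->
  \int[P]_w (\sum_(a <- s) xi a w) ^+ 2 = \sum_(a <- s) \int[P]_w xi a w ^+ 2.
Proof.
elim: s => [_|a s ih /= /andP[as' us]].
  under eq_Rintegral do rewrite big_nil expr0n/=.
  by rewrite big_nil Rintegral_cst// mul0r.
have ixx c : P.-integrable setT (EFin \o (fun w => xi a w * xi c w)).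
  exact: integrable_mul_of_sqr.
have Exx : \int[P]_w (\sum_(c <- s) xi a w * xi c w) = 0.
  rewrite Rintegral_sum// big_seq big1// => c cs.
  rewrite Rintegral_independentM ?Exi ?mul0r//; try exact: integrable_of_sqr.
  by apply: indxi; apply: contraNneq as' => ->.
rewrite big_cons -ih//.
transitivity (\int[P]_w (xi a w ^+ 2 +
    (2 * (\sum_(c <- s) xi a w * xi c w) + (\sum_(c <- s) xi c w) ^+ 2))).
  apply: eq_Rintegral => w _; rewrite big_cons -mulr_sumr; ring.
have iS := integrable_sqr_sum s.
have iX : P.-integrable setT (EFin \o (fun w => \sum_(c <- s) xi a w * xi c w)).
  exact: integrable_EFin_sum.
rewrite RintegralD//; last by apply: integrable_EFinD => //; exact: integrable_EFinZ.
rewrite RintegralD//; last exact: integrable_EFinZ.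
by rewrite RintegralZl// Exx mulr0 add0r.
Qed.

End second_moments.

(** * Lindeberg replacement *)

Section lindeberg_step.
Context {R : realType}.
Local Notation gamma := (normal_prob (0:R) 1).
Context {d dA} {T : measurableType d} {A : measurableType dA} (P : probability T R).
Variable (C : R).
Hypothesis CP : gauss_smoothing_bound C.
Variables (X : T -> A) (Y H : T -> R) (N : A * R -> R) (theta : R).
Hypotheses (mX : measurable_fun setT X) (mY : measurable_fun setT Y)
  (mH : measurable_fun setT H) (XY : independent P X Y)
  (XYH : independent P (fun w => (X w, Y w)) H)
  (Hgauss : forall V, measurable V -> P (H @^-1` V) = gamma V)
  (EY : \int[P]_w Y w = 0)
  (iY2 : P.-integrable setT (EFin \o (fun w => Y w ^+ 2)))
  (mN : measurable_fun setT N)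
  (lipN : forall a x y, `|N (a, x) - N (a, y)| <= `|x - y|)
  (theta0 : 0 < theta).

Let gT := measurableTypeR R.

Let L a := theta^-1 * \int[gamma]_h ((N (a, theta * h) - N (a, 0)) * h).

Let iH2 : P.-integrable setT (EFin \o (fun w => H w ^+ 2)).
Proof.
apply: (@integrable_law R _ _ T gT P gamma H mH Hgauss (fun h : R => h ^+ 2) _).1.
  exact: measurable_funX.
exact: integrable_gauss_sqr.
Qed.

Let iY : P.-integrable setT (EFin \o Y).
Proof.
have h : P.-integrable setT (EFin \o (fun w => cst 1 w + Y w ^+ 2)).
  by apply: integrable_EFinD => //; exact: finite_measure_integrable_cst.
apply: le_integrable_EFin h => // w /=.
rewrite ler_norml; apply/andP; split; nra.
Qed.

Let XH : independent P X H.
Proof.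
move=> U V mU mV; have := XYH (measurableX mU (@measurableT _ R)) mV.
suff -> : (fun w => (X w, Y w)) @^-1` (U `*` setT) = X @^-1` U by [].
by apply/seteqP; split => w //= [].
Qed.

Let g2b a h : `|(N (a, theta * h) - N (a, 0)) * h| <= theta * h ^+ 2.
Proof.
rewrite normrM -[h ^+ 2]real_normK ?num_real// expr2 mulrA ler_wpM2r//.
by rewrite (le_trans (lipN _ _ _))// subr0 normrM gtr0_norm.
Qed.

Let igb (f : R -> R) c : measurable_fun setT f ->
  (forall y, `|f y| <= c + theta * y ^+ 2) -> gamma.-integrable setT (EFin \o f).
Proof.
move=> mf fb; apply: (@le_integrable_EFin _ (measurableTypeR R) R gamma _ _ mf fb).
apply: integrable_EFinD; first exact: finite_measure_integrable_cst.
exact: integrable_EFinZ integrable_gauss_sqr.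
Qed.

Let mNa a : measurable_fun setT (fun z => N (a, z)).
Proof. exact: measurable_fun_pair2. Qed.

Let mg2 : measurable_fun setT
  (fun z : A * gT => (N (z.1, theta * z.2) - N (z.1, 0)) * z.2).
Proof.
have m1 : measurable_fun setT (fun z : A * R => z.1) := measurable_fst.
have m2 : measurable_fun setT (fun z : A * R => z.2) := measurable_snd.
apply: measurable_funM => //; apply: measurable_funB.
  apply: measurableT_comp mN _; apply: measurable_fun_pair => //.
  exact: measurable_funM.
by apply: measurableT_comp mN _; exact: measurable_fun_pair.
Qed.

Let ig2 : P.-integrable setT
  (EFin \o (fun w => (N (X w, theta * H w) - N (X w, 0)) * H w)).
Proof.
have h := integrable_EFinZ theta iH2.
apply: le_integrable_EFin h; last by move=> w; exact: g2b.
exact: measurableT_comp mg2 (measurable_fun_pair mX mH).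
Qed.

Let ig2a a : gamma.-integrable setT
  (EFin \o (fun h => (N (a, theta * h) - N (a, 0)) * h)).
Proof.
apply: (igb (c := 0)) => [|h]; last by rewrite add0r; exact: g2b.
exact: measurable_fun_pair2 mg2.
Qed.

Let mL : measurable_fun setT L.
Proof.
apply: measurable_funM => //.
exact: (@measurable_Rintegral_fubini _ _ _ _ T A gT P X H mX mH XH gamma
  Hgauss _ mg2 ig2 ig2a).
Qed.

Let Lb a : `|L a| <= 2.
Proof.
rewrite normrM gtr0_norm ?invr_gt0// ler_pdivrMl//.
have mg2a : measurable_fun setT (fun h => (N (a, theta * h) - N (a, 0)) * h).
  exact: measurable_fun_pair2 mg2.
have iq : gamma.-integrable setT (EFin \o (fun h : R => theta * h ^+ 2)).
  exact: integrable_EFinZ integrable_gauss_sqr.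
rewrite (le_trans (@norm_Rintegral_le _ gT R gamma _ _ mg2a (g2b a) iq))//.
rewrite RintegralZl//; last exact: integrable_gauss_sqr.
by rewrite ler_pM2l//; exact: gauss_sqr_le2.
Qed.

Let iLY : P.-integrable setT (EFin \o (fun w => L (X w) * Y w)).
Proof.
have h := integrable_EFinZ 2 (integrable_norm iY).
apply: le_integrable_EFin h => [|w].
  by apply: measurable_funM => //; exact: measurableT_comp mL mX.
by rewrite normrM ler_wpM2r.
Qed.

Let ELY : \int[P]_w (L (X w) * Y w) = 0.
Proof.
have mLX : measurable_fun setT (L \o X) by exact: measurableT_comp mL mX.
rewrite (@Rintegral_independentM _ _ _ P (L \o X))//; first by rewrite EY mulr0.
- move=> U V mU mV; apply: (XY (U := L @^-1` U)) => //.
  by rewrite -[_ @^-1` U]setTI; exact: mL.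
- apply: (@le_integrable_EFin _ T R P _ (cst 2)) => //.
    by move=> w; exact: Lb.
  exact: finite_measure_integrable_cst.
Qed.

Let mg1 : measurable_fun setT
  (fun z : (A * R) * gT => N (z.1.1, z.1.2 + theta * z.2) - N (z.1.1, theta * z.2)).
Proof.
have m1 : measurable_fun setT (fun z : A * R * R => z.1) := measurable_fst.
have m2 : measurable_fun setT (fun z : A * R * R => z.2) := measurable_snd.
have m11 : measurable_fun setT (fun z : A * R * R => z.1.1).
  exact: measurableT_comp measurable_fst m1.
have m12 : measurable_fun setT (fun z : A * R * R => z.1.2).
  exact: measurableT_comp measurable_snd m1.
have m2t : measurable_fun setT (fun z : A * R * R => theta * z.2).
  exact: measurable_funM.
apply: measurable_funB; apply: measurableT_comp mN _;
  apply: measurable_fun_pair => //; exact: measurable_funD.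
Qed.

Let g1b a y h : `|N (a, y + theta * h) - N (a, theta * h)| <= `|y|.
Proof. by rewrite (le_trans (lipN _ _ _))// addrK. Qed.

Lemma lindeberg_step :
  `|\int[P]_w (N (X w, Y w + theta * H w) - N (X w, theta * H w))|
  <= C / theta * \int[P]_w Y w ^+ 2.
Proof.
have mW : measurable_fun setT (fun w => (X w, Y w)) by exact: measurable_fun_pair.
have ig1 : P.-integrable setT
    (EFin \o (fun w => N (X w, Y w + theta * H w) - N (X w, theta * H w))).
  apply: le_integrable_EFin (integrable_norm iY); last by move=> w; exact: g1b.
  exact: measurableT_comp mg1 (measurable_fun_pair mW mH).
have ig1a (z : A * R) : gamma.-integrable setT
    (EFin \o (fun h : R => N (z.1, z.2 + theta * h) - N (z.1, theta * h))).
  apply: (igb (c := `|z.2|)).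
    exact: measurable_fun_pair2 mg1.
  by move=> h; rewrite (le_trans (g1b _ _ _))// lerDl mulr_ge0 ?sqr_ge0 ?ltW.
pose G w := \int[gamma]_h (N (X w, Y w + theta * h) - N (X w, theta * h)).
have -> : \int[P]_w (N (X w, Y w + theta * H w) - N (X w, theta * H w)) =
    \int[P]_w G w.
  exact: (@Rintegral_independent _ _ _ _ T (A * R)%type gT P _ H mW mH XYH gamma
    Hgauss _ mg1 ig1 ig1a).
have iG : P.-integrable setT (EFin \o G).
  exact: (@integrable_independent _ _ _ _ T (A * R)%type gT P _ H mW mH XYH gamma
    Hgauss _ mg1 ig1 ig1a).
have -> : \int[P]_w G w = \int[P]_w (G w - L (X w) * Y w).
  by rewrite RintegralB// ELY subr0.
rewrite -RintegralZl//; apply: norm_Rintegral_le.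
- apply/measurable_EFinP; exact: measurable_int (integrable_EFinB iG iLY).
- by move=> w; exact: (CP (mNa (X w)) (lipN (X w)) (Y w) theta0).
- exact: integrable_EFinZ.
Qed.

End lindeberg_step.

Section robust_bias.
Context {R : realType} {d} {T : measurableType d} (P : probability T R)
  {A J : finType}.
Local Notation gamma := (normal_prob (0:R) 1).
Variables (xi : A -> T -> R) (eta : J -> T -> R) (b : A -> J) (theta : R).

Let Z (k : A + J) := match k with inl a => xi a | inr j => eta j end.

Hypotheses (mxi : forall a, measurable_fun setT (xi a))
  (meta : forall j, measurable_fun setT (eta j))
  (indZ : mutually_independent P Z)
  (Exi : forall a, \int[P]_w xi a w = 0)
  (ixi : forall a, P.-integrable setT (EFin \o (fun w => xi a w ^+ 2)))
  (gauss_eta : forall j V, measurable V -> P (eta j @^-1` V) = gamma V)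
  (theta0 : 0 < theta).

Variable phi : (J -> R) -> R.
Hypotheses (phi_lip : forall u v (e : R), (forall j, `|u j - v j| <= e) ->
    `|phi u - phi v| <= e)
  (phi_opp : forall u, phi (fun j => - u j) = - phi u)
  (phi_measurable : forall dS (S : measurableType dS) (u : J -> S -> R),
    (forall j, measurable_fun setT (u j)) ->
    measurable_fun setT (fun s => phi (fun j => u j s))).

Let mZ k : measurable_fun setT (Z k).
Proof. by case: k. Qed.

Lemma phi_norm_le u : `|phi u| <= \sum_j `|u j|.
Proof.
have phi0 : phi (fun=> 0) = 0.
  have := phi_opp (fun=> 0); rewrite oppr0; lra.
have := @phi_lip u (fun=> 0) (\sum_j `|u j|); rewrite phi0 subr0; apply => j.
by rewrite subr0 (bigD1 j)//= lerDl sumr_ge0.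
Qed.

Lemma integrable_phi dS (S : measurableType dS) (mu : {measure set S -> \bar R})
    (u : J -> S -> R) :
  (forall j, mu.-integrable setT (EFin \o u j)) ->
  mu.-integrable setT (EFin \o (fun w => phi (fun j => u j w))).
Proof.
move=> iu.
have isum : mu.-integrable setT (EFin \o (fun w => \sum_j `|u j w|)).
  by apply: integrable_EFin_sum => j; exact: integrable_norm.
apply: le_integrable_EFin isum; last by move=> w; exact: phi_norm_le.
apply: phi_measurable => j; apply/measurable_EFinP; exact: measurable_int (iu j).
Qed.

Let measurable_xi (S : pred (A + J)) a : S (inl a) ->
  @measurable_fun _ _ (cylType Z S) R setT (xi a).
Proof. exact: (@measurable_cylinders _ _ T R _ Z S (inl a)). Qed.

Let measurable_eta (S : pred (A + J)) j : S (inr j) ->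
  @measurable_fun _ _ (cylType Z S) R setT (eta j).
Proof. exact: (@measurable_cylinders _ _ T R _ Z S (inr j)). Qed.

Let ieta j : P.-integrable setT (EFin \o eta j).
Proof.
apply: integrable_of_sqr => //.
apply: (@integrable_law R _ _ T (measurableTypeR R) P gamma (eta j) (meta j)
  (@gauss_eta j) (fun h : R => h ^+ 2) _).1; last exact: integrable_gauss_sqr.
exact: measurable_funX.
Qed.

Let sgn_eta (s : seq J) j w := (if j \in s then - 1 else 1) * (theta * eta j w).

Lemma Rintegral_phi_flip s j0 : j0 \notin s ->
  \int[P]_w phi (fun j => sgn_eta (j0 :: s) j w) =
  \int[P]_w phi (fun j => sgn_eta s j w).
Proof.
move=> j0s.
pose S : pred (A + J) := predC1 (inr j0).
pose N (z : cylType Z S * measurableTypeR R) :=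
  phi (fun j => if j == j0 then theta * z.2
    else (if j \in s then - 1 else 1) * (theta * eta j z.1)).
have mid : @measurable_fun _ _ T (cylType Z S) setT id by exact: measurable_id_cylinders.
have mN : measurable_fun setT N.
  apply: phi_measurable => j; have [_|jj0] := eqVneq j j0.
    by apply: measurable_funM => //; exact: measurable_snd.
  apply: measurable_funM => //; apply: measurable_funM => //.
  apply: (@measurableT_comp _ _ _ _ (cylType Z S) R (eta j)); last exact: measurable_fst.
  by apply: measurable_eta; apply: contra jj0 => /eqP [->].
have XH : @independent _ _ _ _ T (cylType Z S) R P id (eta j0).
  by apply: (independent_cylinders mZ indZ (k := inr j0)); rewrite /S /= eqxx.
have NE c w : N (w, c * eta j0 w) =
    phi (fun j => if j == j0 then theta * (c * eta j0 w) else sgn_eta s j w).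
  by [].
have step (c : R) :
    (forall V, measurable V -> P ((fun w => c * eta j0 w) @^-1` V) = gamma V) ->
  \int[P]_w N (w, c * eta j0 w) = \int[P]_w \int[gamma]_h N (w, h).
  move=> cgamma.
  have mH : measurable_fun setT (fun w => c * eta j0 w) by exact: measurable_funM.
  apply: (@Rintegral_independent _ _ _ _ T (cylType Z S) (measurableTypeR R) P id _
     mid mH _ gamma cgamma) => //.
  - move=> U V mU mV; apply: (XH U ( *%R c @^-1` V)) => //.
    by rewrite -[_ @^-1` _]setTI; exact: measurable_funM.
  - apply: integrable_phi => j; have [_|_] := eqVneq j j0;
      by do 2!apply: integrable_EFinZ.
  - move=> r; apply: integrable_phi => j; have [_|_] := eqVneq j j0.
      by apply: integrable_EFinZ; exact: integrable_gauss_id.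
    exact: (@finite_measure_integrable_cst _ (measurableTypeR R) R gamma setT
      ((if j \in s then - 1 else 1) * (theta * eta j r))).
have -> : \int[P]_w phi (fun j => sgn_eta s j w) = \int[P]_w N (w, 1 * eta j0 w).
  apply: eq_Rintegral => w _; rewrite NE; congr phi; apply/funext => j.
  by case: eqP => // ->; rewrite /sgn_eta (negbTE j0s) !mul1r.
have -> : \int[P]_w phi (fun j => sgn_eta (j0 :: s) j w) =
    \int[P]_w N (w, -1 * eta j0 w).
  apply: eq_Rintegral => w _; rewrite NE; congr phi; apply/funext => j.
  by rewrite /sgn_eta in_cons; case: eqP => //= ->; rewrite !mulN1r mulrN.
rewrite !step//.
- move=> V mV; rewrite -(normal_prob_opp mV) -(@gauss_eta j0).
    by congr (P _); apply/seteqP; split => w; rewrite /= mulN1r.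
  by rewrite -[_ @^-1` _]setTI; exact: oppr_measurable.
- move=> V mV; rewrite -(@gauss_eta j0)//.
  by congr (P _); apply/seteqP; split => w; rewrite /= mul1r.
Qed.

Lemma Rintegral_phi_noise : \int[P]_w phi (fun j => theta * eta j w) = 0.
Proof.
have flip (s : seq J) : uniq s ->
    \int[P]_w phi (fun j => sgn_eta s j w) = \int[P]_w phi (fun j => theta * eta j w).
  elim: s => [_|j s ih /= /andP[js us]].
    by apply: eq_Rintegral => w _; congr phi; apply/funext => j; rewrite /sgn_eta mul1r.
  by rewrite Rintegral_phi_flip// ih.
have := flip _ (enum_uniq J).
have -> : \int[P]_w phi (fun j => sgn_eta (enum J) j w) =
    \int[P]_w (- 1 * phi (fun j => theta * eta j w)).
  apply: eq_Rintegral => w _; rewrite mulN1r -phi_opp; congr phi; apply/funext => j.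
  by rewrite /sgn_eta mem_enum mulN1r.
rewrite RintegralZl//; last by apply: integrable_phi => j; exact: integrable_EFinZ.
lra.
Qed.

Let W (s : seq A) j w := \sum_(a <- s | b a == j) xi a w + theta * eta j w.

Let ixi1 a : P.-integrable setT (EFin \o xi a).
Proof. exact: integrable_of_sqr. Qed.

Let iW s : P.-integrable setT (EFin \o (fun w => phi (fun j => W s j w))).
Proof.
apply: integrable_phi => j; apply: integrable_EFinD; last exact: integrable_EFinZ.
exact: integrable_EFin_sum.
Qed.

Variable C : R.
Hypothesis CP : gauss_smoothing_bound C.

Lemma Rintegral_phi_replace a s : a \notin s ->
  `|\int[P]_w (phi (fun j => W (a :: s) j w) - phi (fun j => W s j w))| <=
  C / theta * \int[P]_w xi a w ^+ 2.
Proof.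
move=> as'; set j0 := b a.
pose S : pred (A + J) := fun k => (k != inl a) && (k != inr j0).
pose S' : pred (A + J) := fun k => k != inr j0.
pose N (z : cylType Z S * R) :=
  phi (fun j => \sum_(c <- s | b c == j) (if c == a then 0 else xi c z.1) +
    (if j == j0 then z.2 else theta * eta j z.1)).
have mN : measurable_fun setT N.
  apply: phi_measurable => j; apply: measurable_funD.
    under eq_fun do rewrite big_mkcond/=.
    apply: measurable_sum => c; have [_|_] := eqVneq (b c) j => //.
    have [_|ca] := eqVneq c a => //.
    apply: (@measurableT_comp _ _ _ _ (cylType Z S) R (xi c)); last exact: measurable_fst.
    by apply: measurable_xi; rewrite /S andbT; apply: contra ca => /eqP [->].
  have [_|jj0] := eqVneq j j0; first exact: measurable_snd.
  apply: measurable_funM => //.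
  apply: (@measurableT_comp _ _ _ _ (cylType Z S) R (eta j)); last exact: measurable_fst.
  by apply: measurable_eta; rewrite /S /=; apply: contra jj0 => /eqP [->].
have lipN r x y : `|N (r, x) - N (r, y)| <= `|x - y|.
  apply: phi_lip => j; rewrite opprD addrACA subrr add0r.
  by case: eqP => //; rewrite subrr normr0.
have XY : @independent _ _ _ _ T (cylType Z S) R P id (xi a).
  by apply: (independent_cylinders mZ indZ (k := inl a)); rewrite /S eqxx.
have X'H : @independent _ _ _ _ T (cylType Z S') R P id (eta j0).
  by apply: (independent_cylinders mZ indZ (k := inr j0)); rewrite /S' eqxx.
have XYH : @independent _ _ _ _ T (cylType Z S * R)%type R P
    (fun w => (w, xi a w)) (eta j0).
  apply: (@independent_comp _ _ _ _ _ T (cylType Z S') (cylType Z S * R)%type R P id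
    (eta j0) (fun w => (w, xi a w)) _ X'H).
  apply: measurable_fun_pair; last exact: measurable_xi.
  by apply: measurable_id_cylinders_sub => k /andP[].
have mid : @measurable_fun _ _ T (cylType Z S) setT id by exact: measurable_id_cylinders.
have sumE w j : \sum_(c <- s | b c == j) (if c == a then 0 else xi c w) =
    \sum_(c <- s | b c == j) xi c w.
  rewrite big_seq_cond [RHS]big_seq_cond; apply: eq_bigr => c /andP[cs _].
  by case: eqP => // ca; rewrite -ca cs in as'.
have := lindeberg_step CP mid (mxi a) (meta j0) XY XYH (@gauss_eta j0) (Exi a) (ixi a)
  mN lipN theta0.
apply: le_trans; rewrite le_eqVlt; apply/orP; left; apply/eqP; congr `|_|.
apply: eq_Rintegral => w _; congr (_ - _); congr phi; apply/funext => j.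
  rewrite /W sumE big_cons -/j0 eq_sym /=; case: eqP => // ->.
  by rewrite addrCA addrA.
by rewrite /W sumE; case: eqP => // ->.
Qed.

Lemma Rintegral_phi_bias :
  `|\int[P]_w phi (fun j => \sum_(a | b a == j) xi a w + theta * eta j w)| <=
  C / theta * \sum_a \int[P]_w xi a w ^+ 2.
Proof.
have bound (s : seq A) : uniq s ->
  `|\int[P]_w phi (fun j => W s j w)| <=
  C / theta * \sum_(a <- s) \int[P]_w xi a w ^+ 2.
  elim: s => [_|a s ih /= /andP[as' us]].
    rewrite big_nil mulr0 [X in `|X|](_ : _ = 0) ?normr0// -Rintegral_phi_noise.
    apply: eq_Rintegral => w _; congr phi; apply/funext => j.
    by rewrite /W big_nil add0r.
  rewrite big_cons mulrDr.
  rewrite (le_trans _ (lerD (Rintegral_phi_replace as') (ih us)))//.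
  by rewrite RintegralB// (le_trans _ (ler_normD _ _))// subrK.
by have := bound _ (index_enum_uniq A).
Qed.

End robust_bias.

(** * The median *)

Section median.
Context {R : realType} {m : nat}.
Local Notation J := 'I_(2 * m).+1.
Implicit Types u v : J -> R.

Definition smed v : R := nth 0 (sort <=%R [seq v j | j <- enum J]) m.

Let sorted_values v := sort <=%R [seq v j | j <- enum J].

Let size_values v : size (sorted_values v) = (2 * m).+1.
Proof. by rewrite size_sort size_map size_enum_ord. Qed.

Let count_values (Q : pred R) v : count Q (sorted_values v) = #|[set j | Q (v j)]%SET|.
Proof.
rewrite (permP (permEl (perm_sort _ _))) count_map enumT.
by rewrite cardsE cardE /enum_mem size_filter.
Qed.

Lemma smed_mem v : exists j, smed v = v j.
Proof.
have : smed v \in sorted_values v by rewrite mem_nth// size_values ltnS leq_pmull.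
by rewrite mem_sort => /mapP[j _ ->]; exists j.
Qed.

Let sorted_nth v i k : (i <= k)%N -> (k < (2 * m).+1)%N ->
  nth 0 (sorted_values v) i <= nth 0 (sorted_values v) k.
Proof.
move=> ik km; apply: (sorted_leq_nth le_trans le_refl) => //.
- exact/sort_sorted/le_total.
- by rewrite inE size_values (leq_ltn_trans ik).
- by rewrite inE size_values.
Qed.

Let m_lt : (m < (2 * m).+1)%N.
Proof. by rewrite ltnS leq_pmull. Qed.

Lemma card_le_smed v : (m < #|[set j | (v j <= smed v)%R]%SET|)%N.
Proof.
rewrite -(count_values (fun x => x <= smed v)).
rewrite -[sorted_values v](cat_take_drop m.+1) count_cat.
rewrite (@leq_trans (count (fun x => x <= smed v) (take m.+1 (sorted_values v))))//;
  last exact: leq_addr.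
have /[!all_count] /eqP -> : all (fun x => x <= smed v) (take m.+1 (sorted_values v)).
  apply/(all_nthP 0) => i; rewrite size_take_min leq_min => /andP[im _].
  by rewrite nth_take// sorted_nth.
by rewrite size_takel// size_values.
Qed.

Lemma card_ge_smed v : (m < #|[set j | (smed v <= v j)%R]%SET|)%N.
Proof.
rewrite -(count_values (fun x => smed v <= x)).
rewrite -[sorted_values v](cat_take_drop m) count_cat.
rewrite (@leq_trans (count (fun x => smed v <= x) (drop m (sorted_values v))))//;
  last exact: leq_addl.
have /[!all_count] /eqP -> : all (fun x => smed v <= x) (drop m (sorted_values v)).
  apply/(all_nthP 0) => i; rewrite size_drop size_values => im.
  by rewrite nth_drop sorted_nth ?leq_addr// -ltn_subRL.
by rewrite size_drop size_values; lia.
Qed.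

Let card_majorities (X Y : {set J}) : (m < #|X|)%N -> (m < #|Y|)%N -> ~~ [disjoint X & Y].
Proof.
move=> mX mY; apply/negP => XY.
have : (#|(X :|: Y)%SET| <= (2 * m).+1)%N by rewrite -[X in (_ <= X)%N]card_ord max_card.
by rewrite cardsU disjoint_setI0// cards0; lia.
Qed.

Lemma smed_le v t : (smed v <= t) = (m < #|[set j | (v j <= t)%R]%SET|)%N.
Proof.
apply/idP/idP => [vt|mt].
  apply: leq_trans (card_le_smed v) (subset_leq_card _).
  by apply/fintype.subsetP => j; rewrite !inE => /le_trans; exact.
have /pred0Pn[j] := card_majorities mt (card_ge_smed v).
by rewrite !inE => /andP[? /le_trans]; exact.
Qed.

Lemma smed_lt v t : (smed v < t) = (m < #|[set j | (v j < t)%R]%SET|)%N.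
Proof.
apply/idP/idP => [vt|mt].
  apply: leq_trans (card_le_smed v) (subset_leq_card _).
  by apply/fintype.subsetP => j; rewrite !inE => /le_lt_trans; exact.
have /pred0Pn[j] := card_majorities mt (card_ge_smed v).
by rewrite !inE => /andP[jt /le_lt_trans]; exact.
Qed.

Lemma smed_ge v t : (t <= smed v) = (m < #|[set j | (t <= v j)%R]%SET|)%N.
Proof.
apply/idP/idP => [vt|mt].
  apply: leq_trans (card_ge_smed v) (subset_leq_card _).
  by apply/fintype.subsetP => j; rewrite !inE; exact: le_trans.
have /pred0Pn[j] := card_majorities mt (card_le_smed v).
by rewrite !inE => /andP[/le_trans]; exact.
Qed.

Lemma smed_lip u v (e : R) : (forall j, `|u j - v j| <= e) -> `|smed u - smed v| <= e.
Proof.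
have half (u' v' : J -> R) : (forall j, `|u' j - v' j| <= e) -> smed u' <= smed v' + e.
  move=> uv; rewrite smed_le; apply: leq_trans (card_le_smed v') (subset_leq_card _).
  apply/fintype.subsetP => j; rewrite !inE => vj.
  by have := uv j; rewrite ler_norml => /andP[_]; lra.
move=> uv; have h1 := half _ _ uv.
have h2 := half v u (fun j => eq_ind _ (fun x => x <= e) (uv j) _ (distrC _ _)).
by rewrite ler_norml; apply/andP; split; lra.
Qed.

Lemma smed_opp u : smed (fun j => - u j) = - smed u.
Proof.
apply/eqP; rewrite eq_le smed_le smed_ge; apply/andP; split.
- apply: leq_trans (card_ge_smed u) (subset_leq_card _).
  by apply/fintype.subsetP => j; rewrite !inE lerN2.
- apply: leq_trans (card_le_smed u) (subset_leq_card _).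
  by apply/fintype.subsetP => j; rewrite !inE lerN2.
Qed.

Lemma smedD u c : smed (fun j => u j + c) = smed u + c.
Proof.
apply/eqP; rewrite eq_le smed_le smed_ge; apply/andP; split.
- apply: leq_trans (card_le_smed u) (subset_leq_card _).
  by apply/fintype.subsetP => j; rewrite !inE lerD2r.
- apply: leq_trans (card_ge_smed u) (subset_leq_card _).
  by apply/fintype.subsetP => j; rewrite !inE lerD2r.
Qed.

Lemma measurable_smed dS (S : measurableType dS) (u : J -> S -> R) :
  (forall j, measurable_fun setT (u j)) ->
  measurable_fun setT (fun s => smed (fun j => u j s)).
Proof.
move=> mu mT; apply: (measurability _ (RGenInftyO.measurableE R)) => //.
move=> _ [_ [t ->] <-]; rewrite setTI.
have -> : (fun s => smed (fun j => u j s)) @^-1` `]-oo, t[%classic =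
    \bigcup_(B in [set B : {set J} | (m < #|B|)%N])
      \bigcap_(j in [set j | j \in B]) (u j @^-1` `]-oo, t[%classic).
  apply/seteqP; split => s /=.
    rewrite in_itv/= smed_lt => mt; exists [set j | (u j s < t)%R]%SET => //= j /=.
    by rewrite inE in_itv.
  move=> [B /= mB Bt]; rewrite in_itv/= smed_lt; apply: leq_trans mB (subset_leq_card _).
  by apply/fintype.subsetP => j jB; rewrite inE; have := Bt j jB; rewrite /= in_itv.
apply: fin_bigcup_measurable; first exact: finite_finset.
move=> B _; apply: fin_bigcap_measurable; first exact: finite_finset.
by move=> j _; rewrite -[_ @^-1` _]setTI; exact: mu.
Qed.

End median.

(** * The smoothed median of means *)

Lemma measurable_coord {R : realType} {d : nat} (k : 'I_d) :
  measurable_fun setT (fun v : 'rV[R]_d => v 0 k).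
Proof.
move=> mT; apply: (measurability _ (RGenOpens.measurableE R)) => //.
move=> _ [_ [a [b ->] <-]]; rewrite setTI; apply: sub_sigma_algebra.
have /continuousP := @coord_continuous R 1 d 0 k; apply.
exact: interval_open.
Qed.

Lemma sum_block {V : nmodType} (p n : nat) (b : 'I_(p * n) -> 'I_p) (F : 'I_(p * n) -> V) j :
  (forall q, b q = (q %/ n)%N :> nat) -> (0 < n)%N ->
  \sum_(q | b q == j) F q = \sum_(i < n) F (block_index j i).
Proof.
move=> bE n0.
have qK (i : 'I_n) : b (block_index j i) = j.
  by apply: ord_inj; rewrite bE /= divnMDl// divn_small// addn0.
rewrite (reindex_onto (block_index j) (fun q => Ordinal (ltn_pmod q n0))) => [|q /eqP <-].
  apply: eq_bigl => i; rewrite qK eqxx; apply/eqP/ord_inj => /=.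
  by rewrite modnMDl modn_small.
by apply: ord_inj; rewrite /= bE -divn_eq.
Qed.

Section coordinate.
Context {R : realType} {d : nat} (f : 'rV[R]_d -> R) (x : 'rV[R]_d)
  {dU dT : measure_display} {U : measurableType dU} {T : measurableType dT}
  (Q : probability U R) (P : probability T R)
  (g : {RV Q >-> 'rV[R]_d}) (Sigma : 'M[R]_d) (theta : R) (m n : nat)
  (zeta : 'I_((2 * m).+1 * n) -> {RV P >-> 'rV[R]_d})
  (eta : 'I_(2 * m).+1 -> {RV P >-> 'rV[R]_d}).
Hypotheses (sg : stochastic_gradient_at f x g Sigma)
  (theta0 : 0 < theta) (n0 : (0 < n)%N) (sample : smom_sample g zeta eta).
Variable k : 'I_d.

Local Notation gamma := (normal_prob (0:R) 1).
Local Notation N := ((2 * m).+1 * n)%N.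
Local Notation J := 'I_(2 * m).+1.

Let c : R := grad f x 0 k.
Let xi (q : 'I_N) w := n%:R^-1 * (zeta q w 0 k - c).
Let eps (j : J) w : R := eta j w 0 k.

Let b_subproof (q : 'I_N) : (q %/ n < (2 * m).+1)%N.
Proof. by rewrite ltn_divLR. Qed.

Let b (q : 'I_N) : J := Ordinal (b_subproof q).

Let nR0 : n%:R != 0 :> R.
Proof. by rewrite pnatr_eq0 -lt0n. Qed.

Lemma smom_rv_coord w : smom_rv theta zeta eta w 0 k =
  smed (fun j => \sum_(q | b q == j) xi q w + theta * eps j w) + grad f x 0 k.
Proof.
rewrite -/c -smedD mxE /smed; congr (nth 0 (sort _ _) m); apply: eq_map => j.
rewrite !mxE summxE sum_block//.
rewrite addrAC; congr (_ + _).
rewrite /xi -mulr_sumr sumrB mulrBr sumr_const card_ord -(mulr_natl c) (mulrA _ n%:R).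
by rewrite mulVf// mul1r subrK.
Qed.

Let mg : measurable_fun setT (fun u => g u 0 k).
Proof. exact: measurableT_comp (measurable_coord k) (measurable_funPT g). Qed.

Let mxi q : measurable_fun setT (xi q).
Proof.
apply: measurable_funM => //; apply: measurable_funB => //.
exact: measurableT_comp (measurable_coord k) (measurable_funPT (zeta q)).
Qed.

Let meps j : measurable_fun setT (eps j).
Proof. exact: measurableT_comp (measurable_coord k) (measurable_funPT (eta j)). Qed.

Let ind : mutually_independent P
  (fun i : 'I_N + J => match i with inl q => xi q | inr j => eps j end).
Proof.
have [_ _ indZ] := sample.
apply: (mutually_independent_comp (f := fun (i : 'I_N + J) (v : 'rV[R]_d) =>
  match i with inl _ => n%:R^-1 * (v 0 k - c) | inr _ => v 0 k end) _ _ indZ).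
  move=> [q|j]; last exact: measurable_coord.
  by apply: measurable_funM => //; apply: measurable_funB => //; exact: measurable_coord.
by case.
Qed.

Let gauss_eps j V : measurable V -> P (eps j @^-1` V) = gamma V.
Proof. by have [_ h _] := sample; have [_] := h j; exact. Qed.

Let h u := g u 0 k - c.

Let mh : measurable_fun setT h.
Proof. exact: measurable_funB. Qed.

Let Eh2 : (\int[Q]_u (h u ^+ 2)%:E = (Sigma k k)%:E)%E.
Proof.
have [_ _ /(_ k k)] := sg; rewrite unlock => <-; apply: eq_integral => u _.
by rewrite mxE big_ord1 mxE -expr2 2!mxE.
Qed.

Let ih2 : Q.-integrable setT (EFin \o (fun u => h u ^+ 2)).
Proof.
apply/integrableP; split; first by apply/measurable_EFinP; exact: measurable_funX.
under eq_integral do rewrite /= ger0_norm ?sqr_ge0//.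
by rewrite /= Eh2 ltry.
Qed.

Let Eh : \int[Q]_u h u = 0.
Proof.
have ih := integrable_of_sqr mh ih2.
have ig : Q.-integrable setT (EFin \o (fun u => g u 0 k)).
  have ihc : Q.-integrable setT (EFin \o (fun u => h u + cst (c) u)).
    by apply: integrable_EFinD => //; exact: finite_measure_integrable_cst.
  by apply: eq_integrable ihc => // u _; rewrite /= /h subrK.
rewrite RintegralB//; last exact: finite_measure_integrable_cst.
rewrite Rintegral_cst// [X in fine X](@probability_setT _ _ _ Q) mulr1.
have [_ /(_ k)] := sg; rewrite unlock => Eg _.
by rewrite /Rintegral Eg subrr.
Qed.

Let law q (F : 'rV[R]_d -> R) : measurable_fun setT F ->
  Q.-integrable setT (EFin \o (F \o g)) ->
  P.-integrable setT (EFin \o (F \o zeta q)) /\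
  \int[P]_w F (zeta q w) = \int[Q]_u F (g u).
Proof.
move=> mF iF; have [/(_ q) same _ _] := sample.
have iD : (distribution Q g).-integrable setT (EFin \o F).
  exact/(integrable_law (P := Q) (measurable_funPT g)).
split; first exact/(integrable_law (nu := distribution Q g) (measurable_funPT (zeta q)) same).
rewrite (Rintegral_law (nu := distribution Q g) (measurable_funPT (zeta q)) same)//.
by rewrite (Rintegral_law (nu := distribution Q g) (measurable_funPT g)).
Qed.

Let mcenter : measurable_fun setT (fun v : 'rV[R]_d => v 0 k - c).
Proof. by apply: measurable_funB => //; exact: measurable_coord. Qed.

Let Exi q : \int[P]_w xi q w = 0.
Proof.
have [iz Ez] := law q mcenter (integrable_of_sqr mh ih2).
by rewrite RintegralZl// Ez [\int[Q]_u _]Eh mulr0.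
Qed.

Let ixi_Exi q : P.-integrable setT (EFin \o (fun w => xi q w ^+ 2)) /\
  \int[P]_w xi q w ^+ 2 = n%:R^-1 ^+ 2 * Sigma k k.
Proof.
have mF : measurable_fun setT (fun v : 'rV[R]_d => (v 0 k - c) ^+ 2).
  exact: measurable_funX.
have [iz Ez] := law q mF ih2.
have xiE : (fun w => xi q w ^+ 2) =
    fun w => n%:R^-1 ^+ 2 * (zeta q w 0 k - c) ^+ 2.
  by apply/funext => w; rewrite /xi exprMn.
rewrite xiE; split; first exact: integrable_EFinZ.
by rewrite RintegralZl// Ez /Rintegral Eh2.
Qed.

Let ixi q := (ixi_Exi q).1.

Let sum_Exi2 j : \sum_(q | b q == j) \int[P]_w xi q w ^+ 2 = Sigma k k / n%:R.
Proof.
rewrite sum_block// (eq_bigr (fun=> n%:R^-1 ^+ 2 * Sigma k k)); last first.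
  by move=> i _; rewrite (ixi_Exi _).2.
by rewrite sumr_const card_ord -[_ *+ n]mulr_natl; field.
Qed.

Let v j w := \sum_(q | b q == j) xi q w + theta * eps j w.

Let ieps2 j : P.-integrable setT (EFin \o (fun w => eps j w ^+ 2)).
Proof.
apply: (@integrable_law R _ _ T (measurableTypeR R) P gamma (eps j) (meps j)
  (@gauss_eps j) (fun y : R => y ^+ 2) _).1; last exact: integrable_gauss_sqr.
exact: measurable_funX.
Qed.

Let Eeps2 j : \int[P]_w eps j w ^+ 2 <= 2.
Proof.
rewrite (@Rintegral_law R _ _ T (measurableTypeR R) P gamma (eps j) (meps j)
  (@gauss_eps j) (fun y : R => y ^+ 2)).
- exact: gauss_sqr_le2.
- exact: measurable_funX.
- exact: integrable_gauss_sqr.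
Qed.

Let indxi q q' : q != q' -> independent P (xi q) (xi q').
Proof.
move=> qq'; apply: (independent_pair (i := inl q) (k := inl q') _ ind).
  by case.
by apply: contra qq' => /eqP [->].
Qed.

Let block j := [seq q <- index_enum 'I_N | b q == j].

Let ivsum2 j : P.-integrable setT (EFin \o (fun w => (\sum_(q <- block j) xi q w) ^+ 2)).
Proof. exact: integrable_sqr_sum. Qed.

Let mvsum j : measurable_fun setT (fun w => \sum_(q <- block j) xi q w).
Proof. exact: measurable_sum. Qed.

Let vE j : v j = fun w => \sum_(q <- block j) xi q w + theta * eps j w.
Proof. by apply/funext => w; rewrite /v big_filter. Qed.

Let mv j : measurable_fun setT (v j).
Proof. by rewrite vE; apply: measurable_funD => //; exact: measurable_funM. Qed.

Let vb j w : v j w ^+ 2 <=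
  2 * ((\sum_(q <- block j) xi q w) ^+ 2 + theta ^+ 2 * eps j w ^+ 2).
Proof.
rewrite vE; have := sqr_ge0 (\sum_(q <- block j) xi q w - theta * eps j w).
by rewrite -exprMn; lra.
Qed.

Let ivb j : P.-integrable setT (EFin \o (fun w =>
  2 * ((\sum_(q <- block j) xi q w) ^+ 2 + theta ^+ 2 * eps j w ^+ 2))).
Proof. by apply/integrable_EFinZ/integrable_EFinD => //; exact: integrable_EFinZ. Qed.

Let iv2 j : P.-integrable setT (EFin \o (fun w => v j w ^+ 2)).
Proof.
apply: le_integrable_EFin (ivb j); first exact: measurable_funX.
by move=> w; rewrite ger0_norm ?sqr_ge0.
Qed.

Let Ev2 j : \int[P]_w v j w ^+ 2 <= 4 * (Sigma k k / n%:R + theta ^+ 2).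
Proof.
have Sge0 : 0 <= Sigma k k / n%:R.
  by rewrite -(sum_Exi2 j) sumr_ge0// => q _; apply: Rintegral_ge0 => w _; exact: sqr_ge0.
rewrite (@le_trans _ _ (\int[P]_w (2 * ((\sum_(q <- block j) xi q w) ^+ 2 +
    theta ^+ 2 * eps j w ^+ 2))))//.
  by apply: le_Rintegral => // w _.
rewrite RintegralZl//; last by apply: integrable_EFinD => //; exact: integrable_EFinZ.
rewrite RintegralD//; last exact: integrable_EFinZ.
rewrite Rintegral_sqr_sum//; last by rewrite filter_uniq// index_enum_uniq.
rewrite big_filter sum_Exi2 RintegralZl//.
have := ler_wpM2l (sqr_ge0 theta) (Eeps2 j); lra.
Qed.

Let v2sum w : (smom_rv theta zeta eta w 0 k - grad f x 0 k) ^+ 2 <= \sum_j v j w ^+ 2.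
Proof.
rewrite smom_rv_coord addrK.
have [j ->] := smed_mem (fun j => v j w).
by rewrite (bigD1 j)//= lerDl sumr_ge0// => i _; exact: sqr_ge0.
Qed.

Let isum2 : P.-integrable setT (EFin \o (fun w => \sum_j v j w ^+ 2)).
Proof. exact: (integrable_EFin_sum _ _ (f := fun j w => v j w ^+ 2)). Qed.

Lemma integrable_smom_rv_coord_sqr : P.-integrable setT
  (EFin \o (fun w => (smom_rv theta zeta eta w 0 k - grad f x 0 k) ^+ 2)).
Proof.
apply: le_integrable_EFin isum2; last by move=> w; rewrite ger0_norm ?sqr_ge0.
under eq_fun do rewrite smom_rv_coord addrK.
by apply: measurable_funX; apply: measurable_smed; exact: mv.
Qed.

Lemma smom_rv_coord_sqr :
  \int[P]_w (smom_rv theta zeta eta w 0 k - grad f x 0 k) ^+ 2 <=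
  4 * (2 * m + 1)%:R * (Sigma k k / n%:R + theta ^+ 2).
Proof.
rewrite (@le_trans _ _ (\int[P]_w (\sum_j v j w ^+ 2)))//.
  by apply: le_Rintegral => //; exact: integrable_smom_rv_coord_sqr.
rewrite (Rintegral_sum _ _ (f := fun j w => v j w ^+ 2))//.
rewrite (le_trans (ler_sum _ (fun j _ => Ev2 j)))//.
by rewrite sumr_const card_ord -[leLHS]mulr_natl addn1 mulrA [_ * 4]mulrC.
Qed.

Lemma smom_rv_coord_bias C : gauss_smoothing_bound C ->
  `|mean_vec P (smom_rv theta zeta eta) 0 k - grad f x 0 k| <=
  C / theta * ((2 * m).+1%:R * (Sigma k k / n%:R)).
Proof.
move=> CP.
have := Rintegral_phi_bias b mxi meps ind Exi ixi gauss_eps theta0 smed_lip smed_opp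
  measurable_smed CP.
have -> : \sum_q \int[P]_w xi q w ^+ 2 = (2 * m).+1%:R * (Sigma k k / n%:R).
  rewrite (partition_big b predT)//= (eq_bigr (fun=> Sigma k k / n%:R)) => [|j _].
    by rewrite sumr_const card_ord mulr_natl.
  by rewrite sum_Exi2.
apply: le_trans; rewrite le_eqVlt; apply/orP; left; apply/eqP; congr `|_|.
have ismed : P.-integrable setT (EFin \o (fun w => smed (fun j => v j w))).
  apply: (integrable_phi smed_lip smed_opp measurable_smed) => j.
  exact: integrable_of_sqr.
rewrite [mean_vec _ _ _ _]mxE unlock.
transitivity (\int[P]_w (smed (fun j => v j w) + cst (grad f x 0 k) w) - grad f x 0 k).
  by congr (fine _ - _); apply: eq_integral => w _; rewrite smom_rv_coord.
rewrite RintegralD//; last exact: finite_measure_integrable_cst.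
by rewrite Rintegral_cst// [X in fine X](@probability_setT _ _ _ P) mulr1 addrK.
Qed.

Lemma Sigma_ge0 : 0 <= Sigma k k.
Proof. by rewrite -lee_fin -Eh2 integral_ge0// => u _; rewrite lee_fin sqr_ge0. Qed.

End coordinate.

Lemma stochastic_gradient_at_sym {R : realType} {d : nat} (f : 'rV[R]_d -> R)
    (x : 'rV[R]_d) {dU} {U : measurableType dU} (Q : probability U R)
    (g : {RV Q >-> 'rV[R]_d}) (Sigma : 'M[R]_d) :
  stochastic_gradient_at f x g Sigma -> Sigma^T = Sigma.
Proof.
move=> [_ _ S]; apply/matrixP => i j; rewrite mxE; apply: EFin_inj.
rewrite -!S; congr expectation; apply/funext => u.
have tr_gram (r : 'rV[R]_d) : (r^T *m r)^T = r^T *m r by rewrite trmx_mul trmxK.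
by rewrite -[in LHS]tr_gram [LHS]mxE.
Qed.

Lemma sum_diag_sqr_le_trace {R : realType} (d : nat) (S : 'M[R]_d) : S^T = S ->
  \sum_k S k k ^+ 2 <= \tr (S *m S).
Proof.
move=> symS; apply: ler_sum => i _; rewrite mxE (bigD1 i)//= -expr2 lerDl.
apply: sumr_ge0 => j _.
have -> : S j i = S i j by rewrite -[in LHS]symS mxE.
by rewrite -expr2 sqr_ge0.
Qed.

Theorem lemma4p3 (R : realType) :
  (forall (d : nat) (f : 'rV[R]_d -> R) (x : 'rV[R]_d)
      (dU dT : measure_display) (U : measurableType dU) (T : measurableType dT)
      (Q : probability U R) (P : probability T R)
      (gradxi : 'rV[R]_d -> {RV Q >-> 'rV[R]_d}) (Sigma : 'M[R]_d)
      (theta : R) (m n : nat)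
      (zeta : 'I_((2 * m).+1 * n) -> {RV P >-> 'rV[R]_d})
      (eta : 'I_(2 * m).+1 -> {RV P >-> 'rV[R]_d}),
    (forall y, differentiable f y) ->
    stochastic_gradient_at f x (gradxi x) Sigma ->
    0 < theta -> (0 < m)%N -> (0 < n)%N ->
    smom_sample (gradxi x) zeta eta ->
    ('E_P[(fun w => enorm (smom_rv theta zeta eta w - grad f x) ^+ 2)%R]
     <= (4 * (2 * m + 1)%:R * (\tr Sigma / n%:R + theta ^+ 2 * d%:R))%R%:E)%E)
  /\
  (forall c : R, 0 < c -> exists2 C : R, 0 < C &
    forall (d : nat) (f : 'rV[R]_d -> R) (x : 'rV[R]_d)
      (dU dT : measure_display) (U : measurableType dU) (T : measurableType dT)
      (Q : probability U R) (P : probability T R)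
      (gradxi : 'rV[R]_d -> {RV Q >-> 'rV[R]_d}) (Sigma : 'M[R]_d)
      (theta : R) (m n : nat)
      (zeta : 'I_((2 * m).+1 * n) -> {RV P >-> 'rV[R]_d})
      (eta : 'I_(2 * m).+1 -> {RV P >-> 'rV[R]_d}),
    (forall y, differentiable f y) ->
    stochastic_gradient_at f x (gradxi x) Sigma ->
    0 < theta -> (3 <= m)%N -> (0 < n)%N ->
    smom_sample (gradxi x) zeta eta ->
    m%:R * spectral_norm Sigma <= c * (n%:R * theta ^+ 2) ->
    enorm (mean_vec P (smom_rv theta zeta eta) - grad f x)
    <= C * (m%:R / (theta * n%:R) * Num.sqrt (\tr (Sigma *m Sigma)))).
Proof.
have subE d (u v : 'rV[R]_d) k : (u - v) 0 k = u 0 k - v 0 k by rewrite !mxE.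
split.
  move=> d f x dU dT U T Q P gradxi Sigma theta m n zeta eta _ sg t0 _ n0 sample.
  pose D k w := (smom_rv theta zeta eta w 0 k - grad f x 0 k) ^+ 2.
  have iD k : P.-integrable setT (EFin \o D k).
    exact: (integrable_smom_rv_coord_sqr theta sg n0 sample k).
  have iS : P.-integrable setT (EFin \o (fun w => \sum_k D k w)).
    exact: integrable_EFin_sum.
  rewrite unlock (_ : (\int[P]_w _)%E = (\int[P]_w (\sum_k D k w))%:E); last first.
    rewrite /Rintegral fineK; last exact: integrable_fin_num iS.
    apply: eq_integral => w _; rewrite /enorm sqr_sqrtr ?sumr_ge0//.
      by congr (_%:E); apply: eq_bigr => k _; rewrite subE.
    by move=> k _; exact: sqr_ge0.
  rewrite lee_fin Rintegral_sum//.
  rewrite (le_trans (ler_sum _ (fun k _ => smom_rv_coord_sqr theta sg n0 sample k)))//.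
  rewrite -mulr_sumr big_split/= -mulr_suml sumr_const card_ord.
  by rewrite (mulr_natr _ d).
move=> c _; have [C C0 CP] := @gauss_smoothing R.
exists (3 * C); first by rewrite mulr_gt0.
move=> d f x dU dT U T Q P gradxi Sigma theta m n zeta eta _ sg t0 m3 n0 sample _.
set K := 3 * C * (m%:R / (theta * n%:R)).
have nR0 : 0 < n%:R :> R by rewrite ltr0n.
have K0 : 0 <= K by rewrite !mulr_ge0 ?invr_ge0 ?mulr_ge0// ltW.
have coordK k : `|mean_vec P (smom_rv theta zeta eta) 0 k - grad f x 0 k| <= K * Sigma k k.
  rewrite (le_trans (smom_rv_coord_bias sg t0 n0 sample k CP))//.
  have -> : C / theta * ((2 * m).+1%:R * (Sigma k k / n%:R)) =
      C / (theta * n%:R) * Sigma k k * (2 * m).+1%:R.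
    by field; rewrite !gt_eqF.
  have -> : K * Sigma k k = C / (theta * n%:R) * Sigma k k * (3 * m)%:R.
    by rewrite /K natrM; field; rewrite !gt_eqF.
  rewrite ler_wpM2l ?ler_nat//; last by lia.
  by rewrite mulr_ge0 ?(Sigma_ge0 sg)// divr_ge0 ?mulr_ge0 ?ltW.
rewrite mulrA -/K /enorm.
rewrite (@le_trans _ _ (Num.sqrt (K ^+ 2 * \tr (Sigma *m Sigma))))//.
  rewrite ler_wsqrtr// (le_trans _ (ler_wpM2l (sqr_ge0 K)
    (sum_diag_sqr_le_trace (stochastic_gradient_at_sym sg))))//.
  rewrite mulr_sumr; apply: ler_sum => k _.
  rewrite subE -exprMn -real_normK ?num_real// lerXn2r ?nnegrE//.
  by rewrite mulr_ge0// (Sigma_ge0 sg).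
by rewrite sqrtrM ?sqr_ge0// sqrtr_sqr ger0_norm.
Qed.
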